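(* Let $G$ be an infinite planar graph with exponential growth (with respect to a fixed root $x_0$), with every edge of length $1$, and let $G_n=B(x_0,n)$ and $N=|G_n|$. Assume one unit of demand between every pair of nodes in $G_n$. Then there is a constant $C>0$, independent of $n$, such that for all $n$ sufficiently large, no matter how the demands are routed in $G_n$, there exists a node $v\in G_n$ with $$T_n(v)\ \ge\ C\,\frac{N^2}{\log(N)}.$$
   Context: Graphs are connected and locally finite, and every edge has length $1$; $d$ is the resulting graph distance. A node $x_0$ of $G$ is fixed as the root, and $G_n=B(x_0,n)$ is the subgraph induced on the nodes $y$ with $d(x_0,y)\le n$; $|G_n|$ is its number of nodes. $G$ has exponential growth if there exist $n_0$ and $\lambda>1$ such that $|G_n|\ge\lambda^n$ for all $n\ge n_0$. There is one unit of demand between each unordered pair of distinct nodes of $G_n$, so the total demand is $N(N-1)/2$ with $N=|G_n|$. A routing sends, for each such pair, its unit of demand along paths in $G_n$ joining the two nodes. For a given routing, $T_n(v)$ is the total flow in $G_n$ routed through the node $v$ (demand having $v$ as an endpoint is counted as passing through $v$). *)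

(* Defs.v *)
From mathcomp Require Import all_boot all_order all_algebra finmap.
From mathcomp Require Import all_classical all_reals all_analysis.
Set Implicit Arguments.
Unset Strict Implicit.
Unset Printing Implicit Defensive.
Import Order.TTheory GRing.Theory Num.Theory.
Import numFieldNormedType.Exports.

Local Open Scope classical_set_scope.
Local Open Scope ring_scope.

(* A simple graph is given by its adjacency relation [e] on the node type. *)

Definition simple_graph (V : eqType) (e : rel V) : Prop :=
  symmetric e /\ irreflexive e.

Definition connected_graph (V : eqType) (e : rel V) : Prop :=
  forall x y : V, exists2 p, path e x p & last x p = y.

Definition locally_finite_graph (V : eqType) (e : rel V) : Prop :=
  forall x : V, finite_set [set y | e x y].

Definition has_walk (V : eqType) (e : rel V) (x y : V) (k : nat) : Prop :=
  exists p, [/\ path e x p, last x p = y & size p = k].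

(* The default value 0 is never reached in a connected graph. *)
Definition gdist (V : eqType) (e : rel V) (x y : V) : nat :=
  if pselect (exists k, `[< has_walk e x y k >]) is left h
  then ex_minn h else 0%N.

Definition gball (V : eqType) (e : rel V) (x0 : V) (n : nat) : set V :=
  [set y | (gdist e x0 y <= n)%N].

(* [fset_set] is the given set when that set is finite, as are the balls of a
   locally finite connected graph. *)
Definition gball_size (V : choiceType) (e : rel V) (x0 : V) (n : nat) : nat :=
  #|` fset_set (gball e x0 n)|.

Definition exponential_growth (R : realType) (V : choiceType) (e : rel V)
    (x0 : V) : Prop :=
  exists (n0 : nat) (lambda : R), 1 < lambda /\
    forall n, (n0 <= n)%N -> lambda ^+ n <= (gball_size e x0 n)%:R.

(* A drawing without crossings: nodes are sent to distinct points of the plane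
   and every edge to a simple arc joining its ends, the interior of which meets
   neither a node nor another edge.  [arc x y] and [arc y x] are the same arc,
   traversed in the two directions.  Nodes may accumulate in the plane. *)
Definition plane_drawing (R : realType) (V : eqType) (e : rel V)
    (pos : V -> R * R) (arc : V -> V -> R -> R * R) : Prop :=
  [/\ injective pos,
      forall x y, e x y ->
        [/\ {within `[0, 1], continuous (arc x y)},
            {in `[0, 1] &, injective (arc x y)},
            arc x y 0 = pos x, arc x y 1 = pos y
          & forall t : R, t \in `[0, 1] -> arc y x t = arc x y (1 - t)],
      forall x y z (t : R), e x y -> t \in `]0, 1[ -> arc x y t <> pos z
    & forall x y x' y' (s t : R), e x y -> e x' y' ->
        s \in `]0, 1[ -> t \in `]0, 1[ -> arc x y s = arc x' y' t ->
        (x = x' /\ y = y') \/ (x = y' /\ y = x')].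

Definition planar (R : realType) (V : eqType) (e : rel V) : Prop :=
  exists (pos : V -> R * R) (arc : V -> V -> R -> R * R),
    plane_drawing e pos arc.

(* Paths with at least one edge in the subgraph induced on [A], as the sequence
   of their nodes. *)
Definition is_path_in (V : eqType) (e : rel V) (A : set V) (p : seq V) : Prop :=
  [/\ (1 < size p)%N, uniq p, sorted e p & forall z, z \in p -> A z].

Definition joins (V : eqType) (p : seq V) (u v : V) : Prop :=
  (ohead p = Some u /\ ohead (rev p) = Some v) \/
  (ohead p = Some v /\ ohead (rev p) = Some u).

(* [f p] is the amount of flow sent along the path [p]; a path carries demand
   of the pair of its two ends only.  For finite [A] there are finitely many
   paths in [A], so that the sums below are genuine finite sums. *)
Definition routing (R : realType) (V : choiceType) (e : rel V) (A : set V)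
    (f : seq V -> R) : Prop :=
  (forall p, is_path_in e A p -> 0 <= f p) /\
  (forall u v, A u -> A v -> u <> v ->
     \sum_(p \in [set p | is_path_in e A p /\ joins p u v]) f p = 1).

Definition node_flow (R : realType) (V : choiceType) (e : rel V) (A : set V)
    (f : seq V -> R) (v : V) : R :=
  \sum_(p \in [set p | is_path_in e A p /\ v \in p]) f p.

(* Main.v *)
Require Import Defs.
From mathcomp Require Import all_boot all_order all_algebra finmap.
From mathcomp Require Import all_classical all_reals all_analysis.
From mathcomp Require Import zify ring lra.
Set Implicit Arguments.
Unset Strict Implicit.
Unset Printing Implicit Defensive.

(** The ball [G_n] has a spanning tree of depth [n], and in a planar graph such a
    tree yields a balanced separator contained in two root paths, so with at
    most [2 * n.+1] nodes.  About [N ^ 2] units of demand have to pass through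
    these nodes, hence one of them carries a flow of order [N ^ 2 / n].
    Exponential growth gives [n <= ln N / ln lambda].

    The separator is found without faces, triangulations or the Jordan curve
    theorem: of the topology of the plane, only the parity of crossings enters.
    For polygons, the number of crossings modulo 2 is a sum of contributions of
    the ends of the segments, which cancel along closed walks: two closed walks
    cross evenly.  An arbitrary drawing is first replaced by one with polygons
    in which each edge leaves its ends along straight segments and edges without
    a common end do not cross ([drawing_crossing_form]).  Then the crossings of
    two edges with a common end are governed by a linear order of the
    directions at that node.

    Now consider the paths from the root that end with a half-edge outside the
    tree.  The parity of the crossings of two such paths is a linear order on
    their ends, the order in which they occur along a walk around the tree
    ([contour_frontier]).  Every edge outside the tree is a chord between two
    of these ends.  Since fundamental cycles cross evenly, chords do not
    interleave ([chords_noncross]).  In a non-crossing chord diagram there is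
    a balanced pair of positions that no chord separates
    ([balanced_free_pair]), and the two root paths that lead to it separate the
    graph ([separation], [tree_separator]). *)

(** * Balanced pairs in a non-crossing chord diagram *)
Section FreePair.
Import mathcomp.boot.fintype mathcomp.boot.finset.
Local Open Scope set_scope.
Local Open Scope nat_scope.

(** The chord diagram: [o] is a strict linear order on [P], the chords are the
    pairs [{u, s u}] with [s u != u], and the points counted by the weight are
    the elements of [w], none of which is the end of a chord.  That two chords
    do not interleave is stated as a parity because this is the form in which
    planarity delivers it. *)
Variables (S : finType) (P : pred S) (o : rel S) (s : S -> S) (w : pred S).
Hypothesis o_anti : forall u v, P u -> P v -> u != v -> o u v = ~~ o v u.
Hypothesis o_trans : forall u v t, P u -> P v -> P t ->
  u != v -> v != t -> u != t -> o u v -> o v t -> o u t.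
Hypothesis s_invol : involutive s.
Hypothesis s_P : forall u, P u -> P (s u).
Hypothesis w_P : forall u, w u -> P u.
Hypothesis w_s : forall u, w u -> s u = u.
Hypothesis s_noncross : forall u v, P u -> P v -> s u != u -> s v != v ->
  v != u -> v != s u ->
  o u v (+) o u (s v) (+) (o (s u) v (+) o (s u) (s v)) = false.

(** For [p] before [q] this tells whether [d] lies strictly between them; written
    without reference to the order of [p] and [q], it is additive. *)
Definition side p q d := o p d (+) o q d.
(** A virtual chord [{p, q}] that could be added without crossing an existing
    chord: in the triangulated pictures of the separator theorem, a diagonal of
    a face. *)
Definition free_pair p q := forall d, P d -> d != p -> d != q ->
  s d != p -> s d != q -> side p q d = side p q (s d).
(** The values [o a a] are arbitrary, hence this irreflexive variant. *)
Definition slt a b := (a != b) && o a b.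
Definition inside p q := [set d | [&& P d, slt p d & slt d q]].
Definition weight p q := #|[set d in inside p q | w d]|.

Lemma slt_total u v : P u -> P v -> u != v -> slt u v || slt v u.
Proof.
by move=> pu pv uv; rewrite /slt uv eq_sym uv /= (o_anti pu pv uv); case: (o v u).
Qed.

Lemma slt_trans u v t : P u -> P v -> P t -> slt u v -> slt v t -> slt u t.
Proof.
move=> pu pv pt /andP[uv ouv] /andP[vt ovt]; case: (eqVneq u t) => [E|ut].
  by subst t; move: ouv; rewrite o_anti // ovt.
by rewrite /slt ut; apply: o_trans ouv ovt.
Qed.

Lemma slt_asym u v : P u -> P v -> slt u v -> slt v u = false.
Proof.
move=> pu pv /andP[uv ouv]; apply/negbTE/negP => /andP[_].
by rewrite o_anti // 1?eq_sym // ouv.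
Qed.

Lemma side_inside p q d : P p -> P q -> P d -> slt p q -> d != p -> d != q ->
  side p q d = (d \in inside p q).
Proof.
move=> pp pq pd spq dp dq; rewrite inE pd /= /side /slt eq_sym dp dq /=.
rewrite (o_anti pq pd) 1?eq_sym //.
have : o p d || o d q.
  case: (boolP (o p d)) => //= npd; have dlp : slt d p.
    by rewrite /slt dp (o_anti pd pp dp) npd.
  by case/andP: (slt_trans pd pp pq dlp spq).
by case: (o p d); case: (o d q).
Qed.

Definition rank d := #|[set x | P x && slt x d]|.
Lemma rank_slt u v : P u -> P v -> slt u v -> rank u < rank v.
Proof.
move=> pu pv suv; apply: proper_card; apply/properP; split.
  by apply/subsetP => x; rewrite !inE => /andP[px sx]; rewrite px (slt_trans px pu).
by exists u; rewrite !inE ?pu // /slt eqxx.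
Qed.

Lemma first_in (A : {set S}) x : {in A, forall y, P y} -> x \in A ->
  exists2 m, m \in A & forall y, y \in A -> y != m -> slt m y.
Proof.
move=> AP xA; have [m mA mmin] := @arg_minnP _ x (mem A) rank xA.
exists m => // y yA ym; have := slt_total (AP _ yA) (AP _ mA) ym.
by case/orP=> // /(rank_slt (AP _ yA) (AP _ mA)); rewrite ltnNge mmin.
Qed.

Lemma last_in (A : {set S}) x : {in A, forall y, P y} -> x \in A ->
  exists2 m, m \in A & forall y, y \in A -> y != m -> slt y m.
Proof.
move=> AP xA; have [m mA mmax] := @arg_maxnP _ x (mem A) rank xA.
exists m => // y yA ym; have := slt_total (AP _ yA) (AP _ mA) ym.
by case/orP=> // /(rank_slt (AP _ mA) (AP _ yA)); rewrite ltnNge; move: (mmax _ yA);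
  rewrite /geq /= => ->.
Qed.

Definition balanced p q := (#|w| <= 3 * weight p q) && (3 * weight p q <= 2 * #|w|).

Lemma inside_sub p q p' q' : P p -> P q -> P p' -> P q' ->
  p = p' \/ slt p p' -> q = q' \/ slt q' q -> inside p' q' \subset inside p q.
Proof.
move=> pp pq pp' pq' h1 h2; apply/subsetP => x; rewrite !inE => /and3P[px h h'].
rewrite px /=; apply/andP; split.
  by case: h1 => [->//|h1]; apply: slt_trans h1 h.
by case: h2 => [->//|h2]; apply: slt_trans h' h2.
Qed.

Lemma chord_free p z : P p -> P z -> z = s p -> z != p -> free_pair p z.
Proof.
move=> pp pz E zp d pd dp dz sdp sdz; rewrite /side.
have [Ed|nd] := eqVneq (s d) d; first by rewrite Ed.
have := s_noncross pp pd; rewrite -E => /(_ zp nd dp dz).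
by case: (o p d); case: (o z d); case: (o p (s d)); case: (o z (s d)).
Qed.

Lemma slt_neq p q : slt p q -> p != q. Proof. by case/andP. Qed.

(** The step of Lipton and Tarjan, by induction on the interval.  If [p] is
    the end of a chord leading to [y] inside the interval, then [(p, y)] and
    [(y, q)] are both free, and one of them keeps a third of the weight.
    Otherwise [p] can be replaced by the next position, which loses at most one
    unit of weight.  Either way the weight cannot jump over the target zone
    between one third and two thirds. *)
Lemma free_balanced p q : P p -> P q -> slt p q -> free_pair p q -> 3 <= #|w| ->
  2 * #|w| < 3 * weight p q ->
  exists p' q', [/\ P p', P q', p' != q', free_pair p' q' & slt p' q' && balanced p'
    q'].
Proof.
have [n] := ubnP #|inside p q|; elim: n p q => // n IH p q hn pp pq spq fr N3 big.
have pq_ne := slt_neq spq.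
have step p' q' : P p' -> P q' -> slt p' q' -> free_pair p' q' ->
    inside p' q' \proper inside p q -> #|w| <= 3 * weight p' q' -> exists p' q',
   [/\ P p', P q', p' != q', free_pair p' q' & slt p' q' && balanced p' q'].
  move=> pp' pq' s' f' lt' lo; case: (leqP (3 * weight p' q') (2 * #|w|)) => hi.
    by exists p', q'; split=> //; [exact: slt_neq | rewrite /balanced s' lo hi].
  apply: IH hi => //; apply: leq_trans (proper_card lt') _; by rewrite -ltnS.
have [z zin] : exists z, z \in inside p q.
  apply/set0Pn; rewrite -card_gt0; apply: contraTT big; rewrite -leqNgt leqn0 => /eqP h.
  have : weight p q <= #|inside p q|.
    by apply: subset_leq_card; apply/subsetP => x; rewrite inE => /andP[].
  by rewrite h leqn0 -leqNgt => /eqP->; rewrite muln0.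
have inP : {in inside p q, forall y, P y} by move=> y; rewrite inE => /andP[].
case: (boolP (s p \in inside p q)) => [spin|spin].
  set y := s p in spin; have py := inP _ spin.
  move: (spin); rewrite inE => /and3P[_ spy syq].
  have yp : y != p by rewrite eq_sym slt_neq.
  have f1 : free_pair p y by apply: chord_free.
  have f2 : free_pair y q.
    move=> d pd dy dq sdy sdq.
    have dp : d != p by apply: contraNneq sdy => ->.
    have sdp : s d != p by apply: contraNneq dy => E; rewrite /y -E s_invol.
    have := f1 d pd dp dy sdp sdy; have := fr d pd dp dq sdp sdq.
    by rewrite /side; case: (o p d); case: (o q d); case: (o y d); case: (o p _);
      case: (o q _); case: (o y _).
  have cE : weight p q <= weight p y + weight y q.
    rewrite /weight; apply: leq_trans (leq_card_setU _ _); apply: subset_leq_card.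
    apply/subsetP => x; rewrite !inE => /andP[/and3P[px h1 h2] wx];
      rewrite wx px h1 h2 !andbT /=.
    apply: slt_total => //; apply: contraTneq wx => ->; apply/negP => /w_s.
    by move/eqP; rewrite /y s_invol eq_sym (negbTE yp).
  have sub1 : inside p y \proper inside p q.
    apply/properP; split; first by apply: inside_sub => //; [left|right].
    by exists y => //; rewrite !inE /slt eqxx !andbF.
  have sub2 : inside y q \proper inside p q.
    apply/properP; split; first by apply: inside_sub => //; [right|left].
    by exists y => //; rewrite !inE /slt eqxx /= !andbF.
  case: (leqP #|w| (3 * weight p y)) => h1; first exact: (step p y).
  apply: (step y q) => //; clear - h1 cE big; lia.
have [m min mfirst] := first_in inP zin.
have pm := inP _ min; move: (min); rewrite inE => /and3P[_ spm smq].
have sub : inside m q \proper inside p q.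
  apply/properP; split; first by apply: inside_sub => //; [right|left].
  by exists m => //; rewrite !inE /slt eqxx /= !andbF.
have E x : P x -> (x \in inside p q) = (x == m) || (x \in inside m q).
  move=> px; have [->|xm] /= := eqVneq x m; first by rewrite min.
  apply/idP/idP => [xin|]; last by apply/subsetP; case/andP: sub.
  by move: (xin); rewrite !inE mfirst // px => /and3P[_ _ ->].
have mp : m != p by rewrite eq_sym slt_neq.
have mq : m != q by rewrite slt_neq.
apply: (step m q) => //.
  move=> d pd dm dq sdm sdq; have psd := s_P pd.
  rewrite !side_inside //.
  have nE x : P x -> x != m -> (x \in inside m q) = (x \in inside p q).
    by move=> px xm; rewrite E // (negbTE xm).
  rewrite !nE //; case: (eqVneq d p) => [->|dp].
    by rewrite (negbTE spin) inE /slt eqxx andbF.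
  case: (eqVneq (s d) p) => [Ed|sdp].
    by rewrite -{1}(s_invol d) Ed (negbTE spin) inE /slt eqxx andbF.
  by rewrite -!side_inside //; apply: fr.
have : weight p q <= (weight m q).+1.
  rewrite /weight -add1n -(cards1 m); apply: leq_trans (leq_card_setU _ _).
  apply: subset_leq_card; apply/subsetP => x;
    rewrite !in_setU in_set1 ![_ \in [set _ in _ | _]]inE.
  by move=> /andP[xin ->]; rewrite andbT -E // inP.
clear - N3 big; lia.
Qed.

(** The pair formed by the first and the last position is free and encloses all
    of [w] but two elements; the bound 7 makes this more than two thirds. *)
Lemma balanced_free_pair : 7 <= #|w| ->
  exists p q, [/\ P p, P q, p != q, free_pair p q & slt p q && balanced p q].
Proof.
move=> N7; have [x wx] : exists x, w x.
  by apply/existsP; apply: contraTT N7 => /existsPn h;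
    rewrite -ltnNge (@eq_card0 _ w) // => y; apply/negbTE/h.
pose A := [set d | P d]; have AP : {in A, forall y, P y} by move=> y; rewrite inE.
have xA : x \in A by rewrite inE w_P.
have [p pA pmin] := first_in AP xA.
have [q qA qmax] := last_in AP xA.
have pp := AP _ pA; have pq := AP _ qA.
have inn y : P y -> y != p -> y != q -> y \in inside p q.
  by move=> py yp yq; rewrite inE py pmin ?qmax ?inE.
have c : #|w| <= (weight p q).+2.
  rewrite /weight -(addn2 #|_|) addnC; have h : #|[set p; q]| <= 2 by rewrite cards2;
    case: (_ != _).
  apply: leq_trans (leq_add h (leqnn _)); apply: leq_trans (leq_card_setU _ _).
  apply: subset_leq_card; apply/subsetP => y wy;
    rewrite !in_setU !in_set1 [y \in [set _ in _ | _]]inE.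
  case: (eqVneq y p) => //= yp; case: (eqVneq y q) => //= yq.
  by rewrite inn ?w_P //= -topredE.
have pqne : p != q.
  apply: contraTneq N7 => E; rewrite -ltnNge.
  have : weight p q = 0; last by lia.
  apply/eqP; rewrite cards_eq0; apply/eqP/setP => y; rewrite !inE E.
  apply/negP => /andP[/and3P[py h1 h2] _]; by rewrite (slt_asym pq py h1) in h2.
apply: (free_balanced pp pq) => //; try lia; first by rewrite pmin // eq_sym.
by move=> d pd dp dq sdp sdq; rewrite !side_inside ?inn ?s_P // pmin // eq_sym.
Qed.

End FreePair.

(** * Plane drawings as parities of crossings *)

(** The number of crossings, modulo 2, of the edges [p] and [q], as a sum of
    contributions of their ends: [U w x y] is the parity of the crossings of the
    edge [xy] with the vertical ray above the node [w], and [D w x y] the same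
    with the ray below.  The contribution of an end telescopes along a walk, so
    that two closed walks always have an even number of crossings. *)
Definition crossing (T : Type) (U D : T -> T -> T -> bool) (p q : T * T) :=
  U p.1 q.1 q.2 (+) U p.2 q.1 q.2 (+) (D q.1 p.1 p.2 (+) D q.2 p.1 p.2).

(** What a drawing without crossings provides.  Disjoint edges do not cross.
    For edges at a common node [x] the parity depends on conventions; these are
    such that it compares the edges by a linear order [lt x] of their
    directions. *)
Definition crossing_form (T : eqType) (e : rel T) (U D lt : T -> T -> T -> bool) :=
  [/\ (forall w x y, U w x y = U w y x) /\ (forall w x y, D w x y = D w y x),
      forall x y x' y', e x y -> e x' y' ->
        x != x' -> x != y' -> y != x' -> y != y' ->
        crossing U D (x, y) (x', y') = false,
      forall x y z, e x y -> e x z -> y != z ->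
        crossing U D (x, y) (x, z) = lt x y z,
      forall x y z, e x y -> e x z -> y != z -> lt x y z = ~~ lt x z y &
      forall x y z t, e x y -> e x z -> e x t ->
        y != z -> z != t -> y != t -> lt x y z -> lt x z t -> lt x y t].

(** * A balanced separator made of two root paths *)
Section Tree.
Import mathcomp.boot.fintype mathcomp.boot.finset.
Local Open Scope set_scope.
Local Open Scope nat_scope.

Variables (T : finType) (e : rel T) (r : T) (par : T -> T) (depth : T -> nat).
Hypothesis e_sym : symmetric e.
Hypothesis e_irr : irreflexive e.
Hypothesis par_e : forall x, x != r -> e x (par x).
Hypothesis depth_par : forall x, x != r -> depth x = (depth (par x)).+1.
Hypothesis depth_r : depth r = 0.

Definition rpath x := traject par x (depth x).+1.

Lemma rpath_r : rpath r = [:: r].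
Proof. by rewrite /rpath depth_r. Qed.

Lemma rpath_par x : x != r -> rpath x = x :: rpath (par x).
Proof. by move=> xr; rewrite /rpath depth_par. Qed.

Lemma mem_rpath x : x \in rpath x.
Proof. by rewrite /rpath /= inE eqxx. Qed.

(** Induction along root paths. *)
Lemma depth_ind (P : T -> Prop) :
  P r -> (forall x, x != r -> P (par x) -> P x) -> forall x, P x.
Proof.
move=> Pr Pp x; have [n] := ubnP (depth x); elim: n x => // n IH x.
have [->//|xr] := eqVneq x r; rewrite depth_par // ltnS => h.
by apply: Pp => //; apply: IH.
Qed.

Lemma rpath_depth x y : y \in rpath x -> depth y <= depth x.
Proof.
elim/depth_ind: x => [|x xr IH]; first by rewrite rpath_r inE => /eqP->.
rewrite rpath_par // inE => /orP[/eqP->//|/IH h].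
by rewrite (depth_par xr); apply: leqW.
Qed.

Lemma rpath_eq x y : y \in rpath x -> depth x <= depth y -> y = x.
Proof.
have [->|xr] := eqVneq x r; first by rewrite rpath_r inE => /eqP->.
rewrite rpath_par // inE => /orP[/eqP->//|/rpath_depth h].
by rewrite depth_par // ltnNge h.
Qed.

Fixpoint root_edges_rec n x :=
  if n is n'.+1 then (x, par x) :: root_edges_rec n' (par x) else [::].
Definition root_edges x := root_edges_rec (depth x) x.

(** A dart [(x, y)] is the half of the edge [xy] next to [x].  Chains are lists
    of darts, taken modulo 2. *)
Definition both_darts (p : T * T) := [:: (p.1, p.2); (p.2, p.1)].
Definition root_chain x := flatten [seq both_darts p | p <- root_edges x].
(** A place [(x, y)] is reached by the root path of [x], continued by a half-edge
    towards [y]: it stands for a point on the boundary of a thin neighbourhood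
    of the tree. *)
Definition place_chain (d : T * T) := d :: root_chain d.1.

Lemma root_chain_r : root_chain r = [::].
Proof. by rewrite /root_chain /root_edges depth_r. Qed.

Lemma root_chain_par x :
  x != r -> root_chain x = (x, par x) :: place_chain (par x, x).
Proof. by move=> xr; rewrite /root_chain /root_edges depth_par. Qed.

Lemma root_chain_base x d : d \in root_chain x -> d.1 \in rpath x.
Proof.
elim/depth_ind: x => [|x xr IH]; first by rewrite root_chain_r.
rewrite root_chain_par // rpath_par // => h; rewrite in_cons; case/or3P: h =>
  [/eqP->|/eqP->|/IH->].
- by rewrite eqxx.
- by rewrite mem_rpath orbT.
- by rewrite orbT.
Qed.

Lemma place_chain_base d d' : d' \in place_chain d -> d'.1 \in rpath d.1.
Proof. by rewrite inE => /orP[/eqP->|/root_chain_base//]; apply: mem_rpath. Qed.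

Lemma root_edges_e x p : p \in root_edges x -> e p.1 p.2.
Proof.
elim/depth_ind: x => [|x xr IH]; first by rewrite /root_edges depth_r.
by rewrite /root_edges depth_par //= inE => /orP[/eqP->/=|/IH//]; apply: par_e.
Qed.

(** An end contribution [F] summed over a root path leaves only its two ends. *)
Lemma root_edges_telescope (F : T -> bool) x :
  \big[addb/false]_(p <- root_edges x) (F p.1 (+) F p.2) = F x (+) F r.
Proof.
elim/depth_ind: x => [|x xr IH]; first by rewrite /root_edges depth_r big_nil addbb.
by rewrite /root_edges depth_par //= big_cons IH addbA addbK.
Qed.

Variables (U D : T -> T -> T -> bool) (lt : T -> T -> T -> bool).
Hypothesis form : crossing_form e U D lt.
Local Notation crossing := (crossing U D).

Let U_sym w x y : U w x y = U w y x. Proof. by case: form => -[]. Qed.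
Let D_sym w x y : D w x y = D w y x. Proof. by case: form => -[]. Qed.
Let crossing_disj x y x' y' : e x y -> e x' y' ->
  x != x' -> x != y' -> y != x' -> y != y' -> crossing (x, y) (x', y') = false.
Proof. by case: form => _ + _ _ _; apply. Qed.
Let crossing_adj x y z : e x y -> e x z -> y != z ->
  crossing (x, y) (x, z) = lt x y z.
Proof. by case: form => _ _ + _ _; apply. Qed.
Let lt_anti x y z : e x y -> e x z -> y != z -> lt x y z = ~~ lt x z y.
Proof. by case: form => _ _ _ + _; apply. Qed.
Let lt_trans x y z t : e x y -> e x z -> e x t ->
  y != z -> z != t -> y != t -> lt x y z -> lt x z t -> lt x y t.
Proof. by case: form => _ _ _ _; apply. Qed.

(** Besides its darts, each node [x] gets a stub [(x, x)], an imaginary pendant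
    half-edge that marks the node itself; it is placed last among the darts
    at [x]. *)
Definition label_lt x y z :=
  if z == x then true else if y == x then false else lt x y z.
Definition label x y := (y == x) || e x y.

Lemma label_lt_anti x y z : label x y -> label x z -> y != z ->
  label_lt x y z = ~~ label_lt x z y.
Proof.
rewrite /label /label_lt.
case: (eqVneq y x) => [->|yx]; case: (eqVneq z x) => [->|zx] //=; rewrite ?eqxx //.
exact: lt_anti.
Qed.

Lemma label_lt_trans x y z t : label x y -> label x z -> label x t ->
  y != z -> z != t -> y != t -> label_lt x y z -> label_lt x z t -> label_lt x y t.
Proof.
rewrite /label /label_lt.
case: (eqVneq y x) => [->|yx]; case: (eqVneq z x) => [->|zx];
  case: (eqVneq t x) => [->|tx] //=; rewrite ?eqxx //.
exact: lt_trans.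
Qed.

(** A bilinear form on chains that refines [crossing] to half-edges.  Two
    halves of edges interact only at a common node, where they are compared by
    direction.  The self-crossing of an edge has to be attributed to one of its
    two halves, which [enum_rank] selects. *)
Definition dart_form (d d' : T * T) :=
  (d.1 == d'.1) &&
  (if d.2 == d'.2 then (enum_rank d.1 < enum_rank d.2) && crossing d d
   else label_lt d.1 d.2 d'.2).

Definition chain_form (c c' : seq (T * T)) :=
  \big[addb/false]_(d <- c) \big[addb/false]_(d' <- c') dart_form d d'.

Lemma chain_form_catl a b c : chain_form (a ++ b) c = chain_form a c (+) chain_form b c.
Proof. by rewrite /chain_form big_cat. Qed.
Lemma chain_form_consl d b c : chain_form (d :: b) c = chain_form [:: d] c (+)
  chain_form b c.
Proof. by rewrite -cat1s chain_form_catl. Qed.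
Lemma chain_form_catr a b c : chain_form c (a ++ b) = chain_form c a (+) chain_form c b.
Proof. by rewrite /chain_form -big_split /=; apply: eq_bigr => i _;
  rewrite big_cat. Qed.
Lemma chain_form_consr d b c : chain_form c (d :: b) = chain_form c [:: d] (+)
  chain_form c b.
Proof. by rewrite -cat1s chain_form_catr. Qed.

Lemma chain_form_disj a b : (forall d d', d \in a -> d' \in b -> d.1 != d'.1) ->
  chain_form a b = false.
Proof.
move=> h; rewrite /chain_form big_seq big1 // => d da; rewrite big_seq big1 // => d' db.
by rewrite /dart_form (negbTE (h _ _ da db)).
Qed.

(** For distinct edges at most one pair of half-edges contributes, because they
    share at most one node. *)
Lemma chain_form_edges p q : e p.1 p.2 -> e q.1 q.2 ->
  chain_form (both_darts p) (both_darts q) = crossing p q.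
Proof.
case: p q => [x y] [x' y'] /= exy exy'.
have irr a b : e a b -> a != b by move=> h; apply: contraTneq h => ->; rewrite e_irr.
have xy := irr _ _ exy; have xy' := irr _ _ exy'.
have crl a b p : crossing (a, b) p = crossing (b, a) p.
  by rewrite /crossing /= [U b _ _ (+) _]addbC (D_sym p.1 b) (D_sym p.2 b).
have crr a b p : crossing p (a, b) = crossing p (b, a).
  by rewrite /crossing /= (U_sym p.1 b) (U_sym p.2 b) [D b _ _ (+) _]addbC.
have lte a b c : e a b -> e a c -> b != c -> label_lt a b c = crossing (a, b) (a, c).
  move=> eab eac bc; rewrite crossing_adj // /label_lt.
  by rewrite eq_sym (negbTE (irr _ _ eac)) eq_sym (negbTE (irr _ _ eab)).
rewrite /chain_form /both_darts !big_cons !big_nil /= !addbF /dart_form /=.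
have exy_ : e y x by rewrite e_sym.
have exy'_ : e y' x' by rewrite e_sym.
case: (eqVneq x x') => [?|xx']; [subst x'|].
  case: (eqVneq y y') => [?|yy']; [subst y'|].
    rewrite ?(negbTE xy) ?[y == x]eq_sym ?(negbTE xy) ?eqxx /= (crl y x) (crr y x (x,
      y)).
    have : enum_rank x != enum_rank y :> nat by rewrite (inj_eq val_inj) (inj_eq
      enum_rank_inj).
    by rewrite neq_ltn => /orP[h|h]; rewrite h ltnNge (ltnW h) /= ?addbF ?addFb.
  by rewrite ?(negbTE xy') ?[y == x]eq_sym ?(negbTE xy) /= ?addbF ?addFb lte.
case: (eqVneq y y') => [?|yy']; [subst y'|].
  rewrite ?(negbTE xy) ?[y == x']eq_sym ?(negbTE xy') /= ?addbF ?addFb.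
  by rewrite lte // crl crr.
case: (eqVneq x y') => [?|xy2]; [subst y'|].
  case: (eqVneq y x') => [?|yx']; [subst x'|].
    rewrite /= ?addbF ?addFb crr.
    have : enum_rank x != enum_rank y :> nat by rewrite (inj_eq val_inj) (inj_eq
      enum_rank_inj).
    by rewrite neq_ltn => /orP[h|h];
      rewrite h ltnNge (ltnW h) /= ?addbF ?addFb // crl crr.
  by rewrite /= ?addbF ?addFb lte // crr.
case: (eqVneq y x') => [?|yx']; [subst x'|].
  by rewrite /= ?addbF ?addFb lte // crl.
by rewrite /= crossing_disj.
Qed.

Lemma chain_form_walks (l l' : seq (T * T)) :
  (forall p, p \in l -> e p.1 p.2) -> (forall p, p \in l' -> e p.1 p.2) ->
  chain_form (flatten [seq both_darts p | p <- l]) (flatten [seq both_darts p | p <-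
    l']) =
  \big[addb/false]_(p <- l) \big[addb/false]_(q <- l') crossing p q.
Proof.
move=> hl hl'.
elim: l hl => [|p l IH] hl; first by rewrite /= /chain_form !big_nil.
rewrite big_cons /= -[[:: _, _ & _]]/(both_darts p ++ _) chain_form_catl IH; last first.
  by move=> q ql; apply: hl; rewrite inE ql orbT.
congr (_ (+) _); have ep := hl p (mem_head _ _).
elim: {hl IH} l' hl' => [|q l' IH] hl';
  first by rewrite /= /chain_form /= !big_cons !big_nil.
rewrite big_cons /= -[[:: _, _ & _]]/(both_darts q ++ _) chain_form_catr IH; last first.
  by move=> q' ql; apply: hl'; rewrite inE ql orbT.
by rewrite chain_form_edges // hl' // mem_head.
Qed.

(** The closed walk through the root closed by the edge [p]; the part of the tree
    above the meeting point is walked twice and does not count modulo 2. *)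
Definition fundamental_cycle p := p :: root_edges p.1 ++ root_edges p.2.

Lemma fundamental_cycle_telescope (F : T -> bool) p :
  \big[addb/false]_(q <- fundamental_cycle p) (F q.1 (+) F q.2) = false.
Proof.
rewrite big_cons big_cat /= !root_edges_telescope.
by case: (F p.1); case: (F p.2); case: (F r).
Qed.

(** Closed walks cross evenly: both kinds of end contributions telescope to 0. *)
Lemma fundamental_cycle_crossing p q :
  \big[addb/false]_(i <- fundamental_cycle p) \big[addb/false]_(j <-
    fundamental_cycle q)
     crossing i j = false.
Proof.
under eq_bigr do rewrite big_split /=.
rewrite big_split /= exchange_big /=.
rewrite [X in X (+) _]big1; last by move=> j _;
  apply: (fundamental_cycle_telescope (fun x => U x j.1 j.2)).
rewrite big1 // => i _; exact: (fundamental_cycle_telescope (fun x => D x i.1 i.2)).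
Qed.

(** The order of the places in a walk around the tree, obtained from crossings:
    if the paths of [d] and [d'] separate at [m], then up to a constant that
    depends on [m] only, the parity of their crossings tells on which side of
    the path of [d] the path of [d'] leaves. *)
Definition contour d d' := chain_form (place_chain d) (place_chain d').
Definition flip (d : T * T) := (d.2, d.1).

(** The four orders add up to the crossings of the two fundamental cycles, which
    are even.  In terms of the contour order, two edges outside the tree do not
    interleave. *)
Lemma chords_noncross p q : e p.1 p.2 -> e q.1 q.2 -> 

  (contour p q (+) contour p (flip q)) (+) (contour (flip p) q (+) contour (flip p)
    (flip q)) = false.
Proof.
move=> ep eq; rewrite -(fundamental_cycle_crossing p q) -chain_form_walks; first last.
- by move=> i; rewrite inE mem_cat => /or3P[/eqP->|/root_edges_e|/root_edges_e].
- by move=> i; rewrite inE mem_cat => /or3P[/eqP->|/root_edges_e|/root_edges_e].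
rewrite -!chain_form_catr -chain_form_catl /place_chain.
have E x : flatten [seq both_darts i | i <- fundamental_cycle x] =
  both_darts x ++ (root_chain x.1 ++ root_chain x.2) by rewrite /= map_cat flatten_cat.
rewrite !E; case: p q {E ep eq} => [x y] [x' y'] /=.
have perm (a b : T * T) c c' : perm_eq ((a :: c) ++ (b :: c')) ([:: a; b] ++ (c ++ c')).
  by rewrite /= perm_cons -cat_rcons -cats1 -catA perm_catCA.
rewrite /chain_form -(perm_big _ (perm _ _ _ _)) /=; apply: eq_bigr => i _.
by rewrite -(perm_big _ (perm _ _ _ _)).
Qed.

(** The darts that are followed towards the root, respectively away from it, by
    the tree. *)
Definition isup (d : T * T) := (d.1 != r) && (par d.1 == d.2).
Definition isdown (d : T * T) := (d.2 != r) && (par d.2 == d.1).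
Definition place d := label d.1 d.2 && ~~ isup d.
Definition leaf d := place d && ~~ isdown d.
(** The places at depth [n] and the leaves above that depth: no place of such a
    frontier lies on the path of another one. *)
Definition frontier n d :=
  place d && ((depth d.1 == n) || (depth d.1 < n) && ~~ isdown d).
Definition parent_place (d : T * T) := (par d.1, d.1).

Lemma place_chain_up d : d.1 != r ->
  place_chain d = [:: d, (d.1, par d.1) & place_chain (parent_place d)].
Proof. by move=> dr; rewrite {1}/place_chain root_chain_par. Qed.

(** The two half-edges of the path of [u] that start at [u.1] do not interact
    with [v] when [u.1] is off the root path of [v]. *)
Lemma contour_upl u v : u.1 != r -> u.1 \notin rpath v.1 ->
  contour u v = contour (parent_place u) v.
Proof.
move=> ur uv; rewrite /contour place_chain_up // -cat1s -[_ :: place_chain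
  (parent_place u)]cat1s catA chain_form_catl.
rewrite chain_form_disj // => d d'; rewrite !inE => dd /place_chain_base d'v.
apply: contraNneq uv => E; rewrite -E in d'v.
by case/orP: dd d'v => /eqP->.
Qed.

Lemma contour_upr u v : u.1 != r -> u.1 \notin rpath v.1 ->
  contour v u = contour v (parent_place u).
Proof.
move=> ur uv; rewrite /contour (place_chain_up ur) -cat1s -[_ :: place_chain
  (parent_place u)]cat1s catA chain_form_catr.
rewrite chain_form_disj // => d d' /place_chain_base d'v; rewrite !inE => dd.
apply: contraNneq uv => E; rewrite E in d'v.
by case/orP: dd d'v => /eqP->.
Qed.

Lemma par_neq m : m != r -> par m != m.
Proof. by move=> mr; apply: contraTneq (par_e mr) => ->; rewrite e_irr. Qed.

Lemma rpath_par_notin m : m != r -> m \notin rpath (par m).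
Proof.
move=> mr; apply/negP => /rpath_depth; rewrite (depth_par mr); by rewrite ltnn.
Qed.

(** For two places at the same node [m] only the three directions [a], [b] and
    the parent of [m] interact; the remaining term is a constant of [m]. *)
Lemma contour_base m a b : place (m, a) -> place (m, b) -> a != b ->
  contour (m, a) (m, b) = label_lt m a b (+) chain_form (root_chain m) (root_chain m)
    (+)
   (if m == r then false else label_lt m a (par m) (+) label_lt m (par m) b).
Proof.
move=> pa pb ab; rewrite /contour /place_chain /= chain_form_consl (chain_form_consr
  _ _ [:: (m, a)]) (chain_form_consr _ _ (root_chain m)).
have -> : chain_form [:: (m, a)] [:: (m, b)] = label_lt m a b.
  by rewrite /chain_form !big_cons !big_nil /dart_form /= eqxx (negbTE ab) /= !addbF.
case: (eqVneq m r) => [->|mr];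
  first by rewrite root_chain_r /chain_form !big_cons !big_nil ?big_nil ?addbF.
have ne c : place (m, c) -> (par m == c) = false.
  by rewrite /place /isup /= mr /= => /andP[_ /negbTE].
have -> : chain_form [:: (m, a)] (root_chain m) = label_lt m a (par m).
  rewrite root_chain_par // chain_form_consr [X in _ (+) X]chain_form_disj ?addbF;
    last first.
    move=> d d'; rewrite inE => /eqP-> /place_chain_base /= h.
    by apply: contraTneq h => <-; apply: rpath_par_notin.
  by rewrite /chain_form !big_cons !big_nil /dart_form /= eqxx eq_sym (ne _ pa) /=
    !addbF.
have -> : chain_form (root_chain m) [:: (m, b)] = label_lt m (par m) b.
  rewrite root_chain_par // chain_form_consl [X in _ (+) X]chain_form_disj ?addbF;
    last first.
    move=> d d' /place_chain_base /= h; rewrite inE => /eqP->.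
    by apply: contraTneq h => ->; apply: rpath_par_notin.
  by rewrite /chain_form !big_cons !big_nil /dart_form /= eqxx (ne _ pb) /= !addbF.
by case: (label_lt m a b); case: (label_lt m a (par m)); case: (label_lt _ _ _);
  case: (chain_form _ _).
Qed.

Lemma contour_base_anti m a b : place (m, a) -> place (m, b) -> a != b ->
  contour (m, a) (m, b) = ~~ contour (m, b) (m, a).
Proof.
move=> pa pb ab; rewrite !contour_base // 1?eq_sym //.
have na : label m a by case/andP: pa.
have nb : label m b by case/andP: pb.
rewrite (label_lt_anti na nb ab); case: (eqVneq m r) => [_|mr].
  by case: (label_lt m b a); case: (chain_form _ _).
have nm : label m (par m) by rewrite /label par_e ?orbT.
have ne c : place (m, c) -> c != par m.
  by rewrite /place /isup /= mr /= eq_sym => /andP[_].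
rewrite (label_lt_anti na nm (ne _ pa)) (label_lt_anti nb nm (ne _ pb)).
by case: (label_lt m b a); case: (chain_form _ _); case: (label_lt _ _ _);
  case: (label_lt _ _ _).
Qed.

(** Up to a reversal depending on [m], this is the order of the directions at [m]
    cut open at the direction of the parent, that is, a rotation of a linear
    order. *)
Lemma contour_base_trans m a b c : place (m, a) -> place (m, b) -> place (m, c) ->
  a != b -> b != c -> a != c -> contour (m, a) (m, b) -> contour (m, b) (m, c) ->
  contour (m, a) (m, c).
Proof.
move=> pa pb pc ab bc ac; rewrite !contour_base //.
have na : label m a by case/andP: pa.
have nb : label m b by case/andP: pb.
have nc : label m c by case/andP: pc.
have tr := label_lt_trans.
have anti := label_lt_anti.
have ca : c != a by rewrite eq_sym.
have ba : b != a by rewrite eq_sym.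
have cb : c != b by rewrite eq_sym.
have t1 := tr m a b c na nb nc ab bc ac.
have t2 := tr m c b a nc nb na cb ba ca.
move: t1 t2; rewrite (anti m c b) // (anti m b a) // (anti m c a) //.
case: (eqVneq m r) => [_|mr].
  move=> t1 t2.
  have {t1} := introT implyP (fun h => introT implyP (t1 h)).
  have {t2} := introT implyP (fun h => introT implyP (t2 h)).
  by move: (label_lt m a b) (label_lt m b c) (label_lt m a c) (chain_form _ _);
    do 4!case.
have nm : label m (par m) by rewrite /label par_e ?orbT.
have ne x : place (m, x) -> x != par m.
  by rewrite /place /isup /= mr /= eq_sym => /andP[_].
have an x : place (m, x) -> label_lt m (par m) x = ~~ label_lt m x (par m).
  by move=> px; rewrite anti // 1?eq_sym ?ne //; case/andP: px.
(* a label before the parent of m and one after it are ordered accordingly *)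
have lh x y : place (m, x) -> place (m, y) -> x != y ->
    label_lt m x (par m) -> ~~ label_lt m y (par m) -> label_lt m x y.
  move=> px py xy hx hy; apply: (tr m x (par m) y) => //; rewrite ?ne //.
  - by case/andP: px.
  - by case/andP: py.
  - by rewrite eq_sym ne.
  - by rewrite an.
have l1 := introT implyP (fun h => introT implyP (lh _ _ pa pb ab h)).
have l2 := introT implyP (fun h => introT implyP (lh _ _ pb pa ba h)).
have l3 := introT implyP (fun h => introT implyP (lh _ _ pa pc ac h)).
have l4 := introT implyP (fun h => introT implyP (lh _ _ pc pa ca h)).
have l5 := introT implyP (fun h => introT implyP (lh _ _ pb pc bc h)).
have l6 := introT implyP (fun h => introT implyP (lh _ _ pc pb cb h)).
move=> t1 t2.
have {t1} := introT implyP (fun h => introT implyP (t1 h)).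
have {t2} := introT implyP (fun h => introT implyP (t2 h)).
move: l1 l2 l3 l4 l5 l6.
rewrite !an // (anti m c b) // (anti m b a) // (anti m c a) //.
move: (label_lt m a b) (label_lt m b c) (label_lt m a c) (label_lt m a (par m))
  (label_lt m b (par m)) (label_lt m c (par m)) (chain_form _ _).
by do 7!case.
Qed.

Lemma frontierS n u : frontier n.+1 u -> depth u.1 = n.+1 ->
  [/\ u.1 != r, frontier n (parent_place u) & isdown (parent_place u)].
Proof.
case/andP => /andP[nu iu] _ du.
have ur : u.1 != r by apply: contra_eq_neq du => ->; rewrite depth_r.
have pu : depth (par u.1) = n by move: du; rewrite depth_par // => -[].
split=> //; last by rewrite /isdown /= ur eqxx.
rewrite /frontier /place /parent_place /isup /= /label e_sym par_e ?orbT //= pu eqxx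
  andbT negb_and negbK.
have [//|pr /=] := eqVneq (par u.1) r; apply/eqP => E.
by move: pu; rewrite depth_par // E du => /eqP; rewrite eqn_leq ltnNge leqnSn.
Qed.

Lemma frontier_leS n u : frontier n.+1 u -> depth u.1 != n.+1 ->
  frontier n u && (depth u.1 <= n) && ~~ isdown u.
Proof.
move=> /andP[pu]; rewrite orbC; case: eqVneq => //= _; rewrite orbF => /andP[h1 h2] _.
by rewrite /frontier pu h2 /= !andbT -leq_eqVlt -ltnS h1.
Qed.

(** Passing from the frontier of depth [n.+1] to that of depth [n]. *)
Definition climb n u := if depth u.1 == n.+1 then parent_place u else u.

Lemma frontier_climb n u : frontier n.+1 u -> frontier n (climb n u).
Proof.
rewrite /climb => lu; case: eqP => [/(frontierS lu)[]//|/eqP/(frontier_leS lu)].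
by rewrite -andbA => /andP[].
Qed.

Lemma climb_neq n u v : frontier n.+1 u -> frontier n.+1 v -> climb n u != climb n v ->
  contour u v = contour (climb n u) (climb n v).
Proof.
move=> lu lv; rewrite /climb.
case: (eqVneq (depth u.1) n.+1) => [du|du]; case: (eqVneq (depth v.1) n.+1) =>
  [dv|dv] //.
- have [ur _ _] := frontierS lu du; have [vr _ _] := frontierS lv dv.
  move=> ne; have uv : u.1 != v.1 by apply: contraNneq ne => E; rewrite /parent_place E.
  rewrite contour_upl //; last by apply: contraNN uv => /rpath_eq; rewrite du dv => ->.
  rewrite contour_upr //; apply: contraNN uv => /= /rpath_depth /=.
  by rewrite dv -du (depth_par ur) ltnn.
- have [ur _ _] := frontierS lu du => _; rewrite contour_upl //.
  apply/negP => /rpath_depth; rewrite du leqNgt.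
  by have /andP[/andP[_ h] _] := frontier_leS lv dv; rewrite ltnS h.
- have [vr _ _] := frontierS lv dv => _; rewrite contour_upr //.
  apply/negP => /rpath_depth; rewrite dv leqNgt.
  by have /andP[/andP[_ h] _] := frontier_leS lu du; rewrite ltnS h.
Qed.

Lemma climb_eq n u v : frontier n.+1 u -> frontier n.+1 v -> climb n u = climb n v ->
  u != v -> u.1 = v.1.
Proof.
move=> lu lv; rewrite /climb.
case: (eqVneq (depth u.1) n.+1) => [du|du]; case: (eqVneq (depth v.1) n.+1) =>
  [dv|dv] //.
- by case.
- move=> E; have [_ _] := frontierS lu du; rewrite E.
  by case/andP: (frontier_leS lv dv) => _ /negbTE->.
- move=> E; have [_ _] := frontierS lv dv; rewrite -E.
  by case/andP: (frontier_leS lu du) => _ /negbTE->.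
- by move=> ->; rewrite eqxx.
Qed.

(** Frontiers are linearly ordered, by induction on the depth: the order at depth
    [n.+1] is the lexicographic product of the order at depth [n] with the
    orders at the single nodes. *)
Lemma contour_frontier n :
  (forall u v, frontier n u -> frontier n v -> u != v ->
    contour u v = ~~ contour v u) /\
  (forall u v w, frontier n u -> frontier n v -> frontier n w -> u != v -> v != w ->
    u != w ->
     contour u v -> contour v w -> contour u w).
Proof.
have same_anti u v : place u -> place v -> u.1 = v.1 -> u != v ->
  contour u v = ~~ contour v u.
  case: u v => [m a] [m' b] /= pa pb E; subst m' => ne; apply: contour_base_anti => //.
  by apply: contraNneq ne => ->.
have same_trans u v w : place u -> place v -> place w -> u.1 = v.1 -> v.1 = w.1 ->
    u != v -> v != w -> u != w -> contour u v -> contour v w -> contour u w.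
  case: u v w => [m a] [m' b] [m'' c] /= pa pb pc E E'; subst m' m'' => n1 n2 n3.
  apply: contour_base_trans => //.
  - by apply: contraNneq n1 => ->.
  - by apply: contraNneq n2 => ->.
  - by apply: contraNneq n3 => ->.
elim: n => [|n [IHa IHt]].
  have l0 u : frontier 0 u -> place u /\ u.1 = r.
    case/andP => -> /=; rewrite orbF => d0; split=> //; apply/eqP.
    by apply: contraTT d0 => ur; rewrite depth_par.
  split=> [u v /l0[pu ur] /l0[pv vr]|u v w /l0[pu ur] /l0[pv vr] /l0[pw wr]].
    by apply: same_anti; rewrite ?ur.
  by apply: same_trans; rewrite ?ur ?vr.
have pl u : frontier n.+1 u -> place u by case/andP.
have anti u v : frontier n.+1 u -> frontier n.+1 v -> u != v ->
  contour u v = ~~ contour v u.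
  move=> lu lv uv; case: (eqVneq (climb n u) (climb n v)) => [E|ne].
    by apply: same_anti; rewrite ?pl //; apply: (climb_eq lu lv).
  by rewrite (climb_neq lu lv) // (climb_neq lv lu) 1?eq_sym // IHa ?frontier_climb.
split=> // u v w lu lv lw uv vw uw ouv ovw.
have vu : v != u by rewrite eq_sym.
have wv : w != v by rewrite eq_sym.
have wu : w != u by rewrite eq_sym.
case: (eqVneq (climb n u) (climb n v)) => [E1|n1].
  case: (eqVneq (climb n v) (climb n w)) => [E2|n2].
    apply: same_trans ouv ovw => //; rewrite ?pl //; first exact: (climb_eq lu lv).
    exact: (climb_eq lv lw).
  by rewrite (climb_neq lu lw) E1 // -(climb_neq lv lw).
case: (eqVneq (climb n v) (climb n w)) => [E2|n2].
  by rewrite (climb_neq lu lw) -E2 // -(climb_neq lu lv).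
case: (eqVneq (climb n u) (climb n w)) => [E3|n3].
  move: ovw; rewrite (climb_neq lv lw) // -E3 IHa ?frontier_climb // 1?eq_sym //.
  by rewrite -(climb_neq lu lv) ?ouv.
move: ouv ovw; rewrite (climb_neq lu lv) // (climb_neq lv lw) // (climb_neq lu lw) //.
by apply: IHt; rewrite ?frontier_climb.
Qed.

Lemma leaf_frontier d n : leaf d -> depth d.1 < n -> frontier n d.
Proof. by move=> /andP[pd nd] h; rewrite /frontier pd h nd orbT. Qed.

Definition height := (\max_x depth x).+1.
Lemma leaf_bound d : leaf d -> frontier height d.
Proof. by move=> ld; apply: leaf_frontier ld _; rewrite ltnS leq_bigmax. Qed.

Lemma contour_anti u v : leaf u -> leaf v -> u != v -> contour u v = ~~ contour v u.
Proof. by move=> lu lv; apply: (contour_frontier height).1; apply: leaf_bound. Qed.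

Lemma contour_trans u v w : leaf u -> leaf v -> leaf w -> u != v -> v != w -> u != w ->
     contour u v -> contour v w -> contour u w.
Proof. by move=> lu lv lw; apply: (contour_frontier height).2; apply: leaf_bound. Qed.

Definition stub (d : T * T) := d.2 == d.1.

Lemma leaf_rev d : leaf d -> leaf (flip d).
Proof.
case/andP => /andP[n iu] idn; apply/andP; split=> //; apply/andP; split=> //.
by move: n; rewrite /label /= e_sym eq_sym.
Qed.

Lemma stub_leaf d : stub d -> leaf d.
Proof.
case: d => x y /eqP /= ->; rewrite /leaf /place /label /isup /isdown /= eqxx /=.
by case: (eqVneq x r) => //= xr; rewrite (negbTE (par_neq xr)).
Qed.

Lemma stub_rev d : stub d -> flip d = d.
Proof. by case: d => x y /eqP /= ->. Qed.

Lemma card_stub : #|stub| = #|T|.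
Proof.
have inj : injective (fun x : T => (x, x)) by move=> x y [].
rewrite -(card_codom inj); apply: eq_card => -[x y].
apply/eqP/codomP => /= [->|[z [-> ->]] //]; by exists x.
Qed.

Lemma leaf_noncross u v : leaf u -> leaf v -> flip u != u -> flip v != v ->
  v != u -> v != flip u ->
  contour u v (+) contour u (flip v) (+) (contour (flip u) v (+) contour (flip u)
    (flip v)) = false.
Proof.
have el d : leaf d -> flip d != d -> e d.1 d.2.
  case: d => x y /andP[/andP[/orP[/eqP/= ->|//] _] _]; by rewrite eqxx.
by move=> lu lv nu nv _ _; apply: chords_noncross; apply: el.
Qed.

(** Off the base path of [d], the direction [y] of a place does not matter. *)
Lemma contour_root_chain d v y : v \notin rpath d.1 ->
  contour d (v, y) = chain_form (place_chain d) (root_chain v).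
Proof.
move=> vd; rewrite /contour /place_chain [in LHS]chain_form_consr [X in X (+)
  _]chain_form_disj // => a b /place_chain_base ha.
by rewrite inE => /eqP-> /=; apply: contraNneq vd => <-.
Qed.

Lemma root_chain_form_par d v : v != r -> v \notin rpath d.1 ->
  par v \notin rpath d.1 ->
  chain_form (place_chain d) (root_chain v) = chain_form (place_chain d) (root_chain
    (par v)).
Proof.
move=> vr vd pd; rewrite root_chain_par // /place_chain /= -(cat1s (v, _)) -(cat1s
  (par v, _)) catA chain_form_catr.
rewrite [X in X (+) _]chain_form_disj // => a b /place_chain_base ha; rewrite !inE =>
  hb.
by case/orP: hb => /eqP-> /=; [apply: contraNneq vd => <-|apply: contraNneq pd => <-].
Qed.

(** Removing the base paths of a free pair separates the nodes by their side.
    Along a tree edge the side does not change because the paths of both ends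
    differ only away from the base paths; along any other edge it does not
    change because the corresponding chord does not cross the pair. *)
Lemma separation p q v w : free_pair leaf contour flip p q -> e v w ->
  v \notin rpath p.1 -> v \notin rpath q.1 ->
  w \notin rpath p.1 -> w \notin rpath q.1 ->
  side contour p q (v, v) = side contour p q (w, w).
Proof.
move=> fr evw vp vq wp wq; rewrite /side.
have [/orP[|] /andP[nr /eqP E]|nt] := boolP (isup (v, w) || isdown (v, w)).
- by simpl in *; subst w; rewrite !contour_root_chain // !(root_chain_form_par nr).
- by simpl in *; subst v; rewrite !contour_root_chain // !(root_chain_form_par nr).
have lvw : leaf (v, w).
  by move: nt; rewrite /leaf /place /label evw orbT negb_or.
have ne x y d : x \notin rpath d.1 -> (x, y) != d.
  by apply: contraNneq => <- /=; apply: mem_rpath.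
have := fr (v, w) lvw; rewrite /flip /= !ne // => /(_ isT isT isT isT).
by rewrite /side !contour_root_chain.
Qed.

(** The side of a balanced free pair. Up to the nodes on the two root paths, one
    third of the nodes lies on each side. *)
Theorem tree_separator : 7 <= #|T| ->
  exists x z (I : pred T),
  let X := rpath x ++ rpath z in
  [/\ forall v w, v \notin X -> w \notin X -> e v w -> I v = I w,
      #|T| <= 3 * (#|[pred v | (v \notin X) && I v]| + size X) &
      #|T| <= 3 * (#|[pred v | (v \notin X) && ~~ I v]| + size X)].
Proof.
rewrite -card_stub => N7.
have [p [q [lp lq pq fr /andP[spq /andP[b1 b2]]]]] :=
  balanced_free_pair contour_anti contour_trans (s := flip) (fun d =>
    let: (x, y) := d in erefl)
    leaf_rev stub_leaf stub_rev leaf_noncross N7.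
pose I v := side contour p q (v, v).
exists p.1, q.1, I; set X := _ ++ _; cbv zeta.
have inj : injective (fun x : T => (x, x)) by move=> x y [].
pose J := [set v | (v, v) \in inside leaf contour p q].
have weightE : weight leaf contour stub p q = #|J|.
  rewrite -(card_imset _ inj); apply: eq_card => -[x y]; rewrite [LHS]inE /=.
  apply/andP/imsetP => [[xin /eqP /= E]|[z]]; last first.
    by rewrite inE => zin [-> ->]; rewrite /stub /= eqxx.
  by subst y; exists x; rewrite // inE.
have notX v : v \notin X -> v \notin rpath p.1 /\ v \notin rpath q.1.
  by rewrite mem_cat negb_or => /andP.
have JI v : v \notin X -> I v = (v \in J).
  move=> /notX[vp vq]; rewrite inE /I.
  have ne d : v \notin rpath d.1 -> (v, v) != d.
    by apply: contraNneq => <- /=; apply: mem_rpath.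
  by rewrite (side_inside contour_anti contour_trans) ?ne //; apply: stub_leaf;
    rewrite /stub /=.
have XS : #|[set v in X]| <= size X by rewrite cardsE card_size.
split.
- move=> v w vX wX evw; have [[vp vq] [wp wq]] := (notX v vX, notX w wX).
  exact: (separation fr evw vp vq wp wq).
- rewrite -[X in 3 * (X + _)]cardsE; apply: leq_trans b1 _;
  rewrite leq_mul2l /= weightE; apply: leq_trans (leq_add (leqnn _) XS).
  apply: leq_trans (leq_card_setU _ _); apply: subset_leq_card; apply/subsetP => v vJ.
  rewrite in_setU [v \in [set _ in X]]inE; case: (boolP (v \in X)) => [_|vX].
    by rewrite orbT.
  by rewrite orbF in_set; apply/andP; rewrite JI.
- have : #|~: J| <= #|[pred v | (v \notin X) && ~~ I v]| + size X.
    rewrite -[X in _ <= X + _]cardsE; apply: leq_trans (leq_add (leqnn _) XS);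
      apply: leq_trans (leq_card_setU _ _).
    apply: subset_leq_card; apply/subsetP => v vJ; rewrite in_setC in vJ.
    rewrite in_setU [v \in [set _ in X]]inE; case: (boolP (v \in X)) => [_|vX].
    by rewrite orbT.
  by rewrite orbF in_set; apply/andP; rewrite JI.
  by have := cardsC J; rewrite card_stub weightE in b1 b2 *; lia.
Qed.

End Tree.

Import Order.TTheory GRing.Theory Num.Theory.
Import numFieldNormedType.Exports.

Local Open Scope classical_set_scope.
Local Open Scope ring_scope.

(** * Parity of the crossings of two segments *)
Section Segments.
Variable R : realFieldType.
Implicit Types p q r v k : R * R.

(** Points are ordered by abscissa; the lexicographic tie-break has the effect of
    tilting the vertical direction slightly, so that no two points are on
    a common vertical line. *)
Definition lexlt p q := (p.1 < q.1) || (p.1 == q.1) && (p.2 < q.2).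
Definition lexle p q := (p.1 < q.1) || (p.1 == q.1) && (p.2 <= q.2).
(** Twice the signed area of the triangle [q r p]. *)
Definition orient q r p := (r.1 - q.1) * (p.2 - q.2) - (r.2 - q.2) * (p.1 - q.1).
Definition below p q r := if lexlt q r then orient q r p < 0 else 0 < orient q r p.
Definition above p q r := if lexlt q r then 0 < orient q r p else orient q r p < 0.
(** Whether the vertical ray above [p] meets the segment [qr].  When [p] is an
    end of the segment, the value is a convention, on which the parity for two
    segments with a common end depends. *)
Definition side_up p q r :=
  ((lexle q p (+) lexle r p) && below p q r)
  (+) ((p == q) && lexlt r q) (+) ((p == r) && lexlt q r).
Definition side_dn q p p' := (lexle q p (+) lexle q p') && above q p p'.
(** The parity of the crossings of [pp'] and [qr]: over the common range of
    abscissas, the segments cross when the vertical order at its left end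
    differs from that at its right end, and these ends are among the four
    points. *)
Definition seg_cross p p' q r :=
  side_up p q r (+) side_up p' q r (+) (side_dn q p p' (+) side_dn r p p').

Lemma lexle_ltN p q : lexle p q = ~~ lexlt q p.
Proof.
by rewrite /lexle /lexlt; case: (ltgtP p.1 q.1) => //= _; rewrite leNgt.
Qed.

Lemma lexP p q : reflect (p.1 < q.1 \/ p.1 = q.1 /\ p.2 < q.2) (lexlt p q).
Proof.
apply: (iffP orP) => [[->|/andP[/eqP-> ->]]|[->|[-> ->]]]; rewrite ?eqxx;
  by [left|right].
Qed.

Lemma lexltNge p q : lexlt p q = ~~ lexle q p.
Proof. by rewrite lexle_ltN negbK. Qed.

Lemma lexlt_total p q : p != q -> lexlt p q = ~~ lexlt q p.
Proof.
case: p q => [a b] [c d]; rewrite /lexlt /= xpair_eqE negb_and.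
by case: (ltgtP a c) => //= _; case: (ltgtP b d).
Qed.

Lemma lexlt_trans p q r : lexlt p q -> lexlt q r -> lexlt p r.
Proof.
move=> /lexP h1 /lexP h2; apply/lexP.
case: h1 => [h1|[h1 h1']]; case: h2 => [h2|[h2 h2']]; rewrite ?h1 -?h2;
  [left|left|left|right] => //.
- exact: lt_trans h2.
- by split=> //; apply: lt_trans h2'.
Qed.

Lemma lexlt_irr p : lexlt p p = false.
Proof. by rewrite /lexlt ltxx eqxx ltxx. Qed.

Lemma lexlt_asym p q : lexlt p q -> lexlt q p = false.
Proof.
by move=> h; apply/negbTE/negP => /(lexlt_trans h); rewrite lexlt_irr.
Qed.

Lemma orientC q r p : orient r q p = - orient q r p.
Proof. rewrite /orient; ring. Qed.

Lemma belowC p q r : q != r -> below p q r = below p r q.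
Proof.
move=> qr; rewrite /below (lexlt_total qr) orientC oppr_lt0 oppr_gt0.
by case: (lexlt r q).
Qed.

Lemma aboveC p q r : q != r -> above p q r = above p r q.
Proof.
move=> qr; rewrite /above (lexlt_total qr) orientC oppr_lt0 oppr_gt0.
by case: (lexlt r q).
Qed.

Lemma side_upC p q r : side_up p q r = side_up p r q.
Proof.
rewrite /side_up; have [->//|qr] := eqVneq q r.
rewrite (belowC _ qr) [lexle q p (+) _]addbC.
by rewrite -addbA [X in _ (+) X]addbC addbA.
Qed.

Lemma side_dnC q p p' : side_dn q p p' = side_dn q p' p.
Proof.
rewrite /side_dn; have [->//|pp] := eqVneq p p'.
by rewrite (aboveC _ pp) addbC.
Qed.

Lemma seg_crossCl p p' q r : seg_cross p p' q r = seg_cross p' p q r.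
Proof. by rewrite /seg_cross !(side_dnC _ p p') [side_up p _ _ (+) _]addbC. Qed.

Lemma seg_crossCr p p' q r : seg_cross p p' q r = seg_cross p p' r q.
Proof. by rewrite /seg_cross !(side_upC _ q r) [side_dn q _ _ (+) _]addbC. Qed.

Definition sepx p p' q r := [/\ p.1 < q.1, p.1 < r.1, p'.1 < q.1 & p'.1 < r.1].
Definition sepy p p' q r := [/\ p.2 < q.2, p.2 < r.2, p'.2 < q.2 & p'.2 < r.2].

Lemma lexleF p q : q.1 < p.1 -> lexle p q = false.
Proof. by move=> h; rewrite /lexle gt_eqF // lt_gtF. Qed.
Lemma lexleT p q : p.1 < q.1 -> lexle p q.
Proof. by move=> h; rewrite /lexle h. Qed.

Lemma seg_cross_sepx p p' q r : sepx p p' q r \/ sepx q r p p' ->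
  seg_cross p p' q r = false.
Proof.
have ne1 (a b : R * R) : a.1 < b.1 -> (a == b) = false.
  by move=> h; apply: contraTF h => /eqP->; rewrite ltxx.
have ne2 (a b : R * R) : b.1 < a.1 -> (a == b) = false.
  by move=> h; apply: contraTF h => /eqP->; rewrite ltxx.
rewrite /seg_cross /side_up /side_dn => -[[h1 h2 h3 h4]|[h1 h2 h3 h4]].
  by rewrite !lexleF // !ne1.
by rewrite !lexleT // !ne2.
Qed.

Lemma orient_neg p q r : q.1 <= p.1 -> p.1 <= r.1 -> q.1 < r.1 ->
  p.2 < q.2 -> p.2 < r.2 -> orient q r p < 0.
Proof.
move=> h1 h2 h3 h4 h5; rewrite /orient.
have -> : (r.1 - q.1) * (p.2 - q.2) - (r.2 - q.2) * (p.1 - q.1) =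
   - ((r.1 - p.1) * (q.2 - p.2) + (p.1 - q.1) * (r.2 - p.2)) by ring.
rewrite oppr_lt0; move: h1; rewrite le_eqVlt => /predU1P[E|h1].
  rewrite E subrr mul0r addr0 mulr_gt0 // subr_gt0 // -E //.
by rewrite ltr_wpDl // ?mulr_ge0 ?mulr_gt0 // ?subr_ge0 ?subr_gt0 // ltW.
Qed.

Lemma orient_pos p q r : q.1 <= p.1 -> p.1 <= r.1 -> q.1 < r.1 ->
  q.2 < p.2 -> r.2 < p.2 -> 0 < orient q r p.
Proof.
move=> h1 h2 h3 h4 h5; rewrite /orient.
have -> : (r.1 - q.1) * (p.2 - q.2) - (r.2 - q.2) * (p.1 - q.1) =
   ((r.1 - p.1) * (p.2 - q.2) + (p.1 - q.1) * (p.2 - r.2)) by ring.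
move: h1; rewrite le_eqVlt => /predU1P[E|h1].
  rewrite E subrr mul0r addr0 mulr_gt0 // subr_gt0 // -E //.
by rewrite ltr_wpDl // ?mulr_ge0 ?mulr_gt0 // ?subr_ge0 ?subr_gt0 // ltW.
Qed.

Lemma btw_below p q r : p.2 < q.2 -> p.2 < r.2 -> lexle q p (+) lexle r p ->
  below p q r /\ ~~ above p q r.
Proof.
wlog qp : q r / lexle q p && ~~ lexle r p.
  move=> W h1 h2; case: (boolP (lexle q p)) => qp; case: (boolP (lexle r p)) =>
    rp //= _.
    by apply: W => //; rewrite ?qp ?rp.
  have ne : q != r by apply: contraNneq qp => ->.
  by rewrite belowC // aboveC //; apply: W => //; rewrite ?qp ?rp.
move=> h1 h2 _; case/andP: qp; rewrite -lexltNge => qp pr.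
have qp1 : q.1 < p.1.
  by move: qp; rewrite /lexle => /orP[//|/andP[_]]; rewrite leNgt h1.
have qr : lexlt q r.
  by apply: lexlt_trans pr; rewrite /lexlt qp1.
have pr1 : p.1 <= r.1 by case/lexP: pr => [/ltW//|[->]].
have := orient_neg (ltW qp1) pr1 (lt_le_trans qp1 pr1) h1 h2.
by rewrite /below /above qr => o; split=> //; rewrite -leNgt ltW.
Qed.

Lemma btw_above p q r : q.2 < p.2 -> r.2 < p.2 -> lexle q p (+) lexle r p ->
  above p q r /\ ~~ below p q r.
Proof.
wlog qp : q r / lexle q p && ~~ lexle r p.
  move=> W h1 h2; case: (boolP (lexle q p)) => qp; case: (boolP (lexle r p)) =>
    rp //= _.
    by apply: W => //; rewrite ?qp ?rp.
  have ne : q != r by apply: contraNneq qp => ->.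
  by rewrite belowC // aboveC //; apply: W => //; rewrite ?qp ?rp.
move=> h1 h2 _; case/andP: qp; rewrite -lexltNge => qp pr.
have pr1 : p.1 < r.1.
  by case/lexP: pr => [//|[_]]; rewrite ltNge (ltW h2).
have qr : lexlt q r.
  apply/lexP; left; move: qp; rewrite /lexle => /orP[/lt_trans->//|/andP[/eqP->]//].
have qp1 : q.1 <= p.1 by move: qp; rewrite /lexle => /orP[/ltW//|/andP[/eqP->]].
have := orient_pos qp1 (ltW pr1) (le_lt_trans qp1 pr1) h1 h2.
by rewrite /below /above qr => o; split=> //; rewrite -leNgt ltW.
Qed.

(** If the segment [pp'] is the lower one, only comparisons of abscissas
    contribute, each of them twice; otherwise nothing contributes. *)
Lemma seg_cross_sepy p p' q r : sepy p p' q r \/ sepy q r p p' ->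
  seg_cross p p' q r = false.
Proof.
have ne1 (a b : R * R) : a.2 < b.2 -> (a == b) = false.
  by move=> h; apply: contraTF h => /eqP->; rewrite ltxx.
have ne2 (a b : R * R) : b.2 < a.2 -> (a == b) = false.
  by move=> h; apply: contraTF h => /eqP->; rewrite ltxx.
have lexC (a b : R * R) : a != b -> lexle a b = ~~ lexle b a.
  by move=> ab; rewrite -lexltNge lexle_ltN (lexlt_total ab).
rewrite /seg_cross /side_up /side_dn => -[[h1 h2 h3 h4]|[h1 h2 h3 h4]].
  rewrite !ne1 // !addbF.
  have a p0 : p0.2 < q.2 -> p0.2 < r.2 ->
      (lexle q p0 (+) lexle r p0) && below p0 q r = lexle q p0 (+) lexle r p0.
    by move=> g1 g2; apply: andb_idr => /(btw_below g1 g2)[].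
  have d q0 : p.2 < q0.2 -> p'.2 < q0.2 ->
      (lexle q0 p (+) lexle q0 p') && above q0 p p' = lexle q0 p (+) lexle q0 p'.
    move=> g1 g2; apply: andb_idr => h; apply: (btw_above g1 g2 _).1.
    by rewrite !(lexC _ q0) ?ne1 // addNb addbN negbK.
  rewrite !a // !d //.
  by case: (lexle q p); case: (lexle q p'); case: (lexle r p); case: (lexle r p').
rewrite !ne2 // !addbF.
have a p0 : q.2 < p0.2 -> r.2 < p0.2 ->
    (lexle q p0 (+) lexle r p0) && below p0 q r = false.
  by move=> g1 g2; apply/negP => /andP[/(btw_above g1 g2)[_ /negP]].
have d q0 : q0.2 < p.2 -> q0.2 < p'.2 ->
    (lexle q0 p (+) lexle q0 p') && above q0 p p' = false.
  move=> g1 g2; apply/negP => /andP[h]; apply/negP; apply: (btw_below g1 g2 _).2.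
  by rewrite !(lexC _ q0) ?ne2 // addNb addbN negbK.
by rewrite !a // !d.
Qed.

Definition on_seg k q r := exists2 t : R, 0 < t < 1 &
  k.1 = q.1 + t * (r.1 - q.1) /\ k.2 = q.2 + t * (r.2 - q.2).

Lemma on_segC k q r : on_seg k q r -> on_seg k r q.
Proof.
case=> t /andP[t0 t1] [k1 k2]; exists (1 - t); first by apply/andP; split; lra.
by rewrite k1 k2; split; ring.
Qed.

Lemma on_seg_lex k q r : on_seg k q r -> lexlt q r -> lexlt q k && lexlt k r.
Proof.
case=> t /andP[t0 t1] [k1 k2] /lexP h.
apply/andP; split; apply/lexP; rewrite k1 k2.
  by case: h => [h|[h h']]; [left|right; split]; nra.
by case: h => [h|[h h']]; [left|right; split]; nra.
Qed.

Lemma on_seg_orient k q r p : on_seg k q r -> exists2 t : R, 0 < t < 1 &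
  orient q k p = t * orient q r p /\ orient k r p = (1 - t) * orient q r p.
Proof.
case=> t t01 [k1 k2]; exists t => //.
by rewrite /orient k1 k2; split; ring.
Qed.

Lemma on_seg_below k q r p : on_seg k q r -> q != r ->
  [/\ below p q k = below p q r, below p k r = below p q r,
      above p q k = above p q r & above p k r = above p q r].
Proof.
wlog qr : q r / lexlt q r.
  move=> W kqr ne; case: (boolP (lexlt q r)) => [h|]; first exact: W.
  rewrite lexlt_total // negbK => h.
  have [] := W r q h (on_segC kqr); first by rewrite eq_sym.
  have /andP[rk kq] := on_seg_lex (on_segC kqr) h.
  have rk' : r != k by apply: contraTneq rk => ->; rewrite lexlt_irr.
  have kq' : k != q by apply: contraTneq kq => ->; rewrite lexlt_irr.
  rewrite eq_sym in ne.
  by rewrite (belowC _ rk') (belowC _ kq') (aboveC _ rk') (aboveC _ kq') (belowC _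
    ne) (aboveC _ ne); split.
move=> kqr _; have /andP[qk kr] := on_seg_lex kqr qr.
have [t /andP[t0 t1] [e1 e2]] := on_seg_orient p kqr.
have t1' : 0 < 1 - t by rewrite subr_gt0.
rewrite /below /above qk kr qr e1 e2.
by rewrite !pmulr_rlt0 // !pmulr_rgt0.
Qed.

Lemma side_up_split k q r p : on_seg k q r -> q != r -> p != k ->
  side_up p q r = side_up p q k (+) side_up p k r.
Proof.
move=> kqr ne pk; have [b1 b2 _ _] := on_seg_below p kqr ne.
rewrite /side_up b1 b2 (negbTE pk) /= !addbF.
have [L1 L2] : lexlt k q = lexlt r q /\ lexlt k r = lexlt q r.
  case: (boolP (lexlt q r)) => [h|].
    have /andP[h1 h2] := on_seg_lex kqr h.
    by rewrite h2 (lexlt_asym h1) (lexlt_asym h).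
  rewrite lexlt_total // negbK => h.
  have /andP[h1 h2] := on_seg_lex (on_segC kqr) h.
  by rewrite h h2 (lexlt_asym h1).
rewrite L1 L2.
by case: (lexle q p); case: (lexle k p); case: (lexle r p); case: (below _ _ _);
   case: (p == q); case: (p == r); case: (lexlt r q); case: (lexlt q r).
Qed.

Lemma side_dn_split k p p' q : on_seg k p p' -> p != p' ->
  side_dn q p p' = side_dn q p k (+) side_dn q k p'.
Proof.
move=> kqr ne; have [_ _ b1 b2] := on_seg_below q kqr ne.
rewrite /side_dn b1 b2.
by case: (lexle q p); case: (lexle q k); case: (lexle q p'); case: (above _ _ _).
Qed.

(** The parity is additive under subdivision, because the two contributions of
    the new point cancel. *)
Lemma seg_cross_splitl k p p' q r : on_seg k p p' -> p != p' ->
  seg_cross p p' q r = seg_cross p k q r (+) seg_cross k p' q r.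
Proof.
move=> kp ne; rewrite /seg_cross !(side_dn_split _ kp ne).
by case: (side_up p q r); case: (side_up k q r); case: (side_up p' q r);
   case: (side_dn q p k); case: (side_dn q k p'); case: (side_dn r p k);
   case: (side_dn r k p').
Qed.

Lemma seg_cross_splitr k p p' q r : on_seg k q r -> q != r -> p != k -> p' != k ->
  seg_cross p p' q r = seg_cross p p' q k (+) seg_cross p p' k r.
Proof.
move=> kp ne pk pk'; rewrite /seg_cross !(side_up_split kp ne) //.
by case: (side_up p q k); case: (side_up p k r); case: (side_up p' q k);
   case: (side_up p' k r); case: (side_dn q p p'); case: (side_dn r p p');
   case: (side_dn k p p').
Qed.

(** The order of directions at [v], counterclockwise, beginning just after
    straight down. *)
Definition angle_lt v p q :=
  if lexlt v p then (if lexlt v q then 0 < orient v p q else true)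
  else (if lexlt v q then false else 0 < orient v p q).
Definition same_ray v p q := (lexlt v p == lexlt v q) && (orient v p q == 0).

Lemma orient0l p q : orient p q p = 0. Proof. rewrite /orient; ring. Qed.
Lemma orient0r p q : orient q p p = 0. Proof. rewrite /orient; ring. Qed.

(** The convention for coinciding ends in [side_up] was chosen to make this true
    for all positions of [p] and [q]. *)
Lemma seg_cross_angle v p q : p != v -> q != v -> ~~ same_ray v p q ->
  seg_cross v p v q = angle_lt v p q.
Proof.
move=> pv qv; rewrite /same_ray /seg_cross /side_up /side_dn /angle_lt.
have lexx : lexle v v by rewrite /lexle eqxx lexx orbT.
have vp : (v == p) = false by rewrite eq_sym (negbTE pv).
have vq : (v == q) = false by rewrite eq_sym (negbTE qv).
rewrite lexx !eqxx (negbTE pv) vq /= !addbF.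
have -> : below v v q = false by rewrite /below orient0l ltxx if_same.
have -> : above v v p = false by rewrite /above orient0l ltxx if_same.
rewrite !andbF /= ?addbF ?addFb.
have [->|pq] := eqVneq p q; first by rewrite eqxx orient0r eqxx.
rewrite !lexle_ltN /below /above.
rewrite (lexlt_total qv) (lexlt_total pv) !negbK (lexlt_total pq).
have qp : lexlt q p = ~~ lexlt p q by rewrite lexlt_total // eq_sym.
case: (boolP (lexlt v p)) => h1; case: (boolP (lexlt v q)) => h2; rewrite ?eqxx /= =>
  ne.
- have o : orient v q p = - orient v p q by rewrite /orient; ring.
  rewrite o oppr_lt0; by case: (lexlt q p) => /=; rewrite ?andbF ?andbT ?addbF ?addFb.
- have -> : lexlt q p.
    apply: lexlt_trans h1; by rewrite lexlt_total // h2.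
  by [].
- have -> : lexlt q p = false.
    apply: negbTE; rewrite qp negbK; apply: lexlt_trans h2;
      by rewrite lexlt_total // h1.
  by [].
- have o : orient v q p = - orient v p q by rewrite /orient; ring.
  rewrite o ?oppr_gt0 ?oppr_lt0 .
  case: (lexlt q p) => //=; case: (ltgtP (orient v p q) 0) ne => //.
Qed.

Lemma angle_lt_anti v p q : ~~ same_ray v p q -> angle_lt v p q = ~~ angle_lt v q p.
Proof.
rewrite /same_ray /angle_lt => ne.
have o : orient v q p = - orient v p q by rewrite /orient; ring.
case: (lexlt v p) ne; case: (lexlt v q) => //=; rewrite o oppr_gt0;
  by case: (ltgtP (orient v p q) 0).
Qed.

(** Within a half plane, orientation is transitive by a Pluecker relation. *)
Lemma angle_lt_trans v p q r : p != v -> q != v -> r != v ->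
  ~~ same_ray v p r -> angle_lt v p q -> angle_lt v q r -> angle_lt v p r.
Proof.
move=> pv qv rv; rewrite /same_ray /angle_lt.
have id : (q.1 - v.1) * orient v p r =
    orient v p q * (r.1 - v.1) + orient v q r * (p.1 - v.1).
  by rewrite /orient; ring.
case: (boolP (lexlt v p)) => h1; case: (boolP (lexlt v q)) => h2;
  case: (boolP (lexlt v r)) => h3 //= ne a b.
- have p1 : 0 <= p.1 - v.1 by case/lexP: h1 => [/ltW|[->]] h; rewrite subr_ge0.
  have r1 : 0 <= r.1 - v.1 by case/lexP: h3 => [/ltW|[->]] h; rewrite subr_ge0.
  have q1 : 0 < q.1 - v.1.
    case/lexP: h2 => [|[E h]]; first by rewrite subr_gt0.
    by move: b; rewrite /orient E subrr mul0r sub0r oppr_gt0 pmulr_rlt0 ?subr_gt0 //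
      ltNge -E r1.
  rewrite lt_neqAle eq_sym ne -(pmulr_rge0 _ q1) id.
  by rewrite addr_ge0 // mulr_ge0 // ltW.
- have lexN w : w != v -> ~~ lexlt v w -> lexlt w v.
    by move=> wv; rewrite (lexlt_total wv).
  have {h1}h1 := lexN _ pv h1; have {h2}h2 := lexN _ qv h2; have {h3}h3 := lexN _ rv h3.
  have p1 : p.1 - v.1 <= 0 by case/lexP: h1 => [/ltW|[->]] h; rewrite subr_le0.
  have r1 : r.1 - v.1 <= 0 by case/lexP: h3 => [/ltW|[->]] h; rewrite subr_le0.
  have q1 : q.1 - v.1 < 0.
    case/lexP: h2 => [|[E h]]; first by rewrite subr_lt0.
    move: b; rewrite /orient E subrr mul0r sub0r oppr_gt0 nmulr_rlt0 ?subr_lt0 //.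
    by rewrite ltNge r1.
  rewrite lt_neqAle eq_sym ne -(nmulr_rle0 _ q1) id.
  by rewrite -oppr_ge0 opprD -!mulrN addr_ge0 // mulr_ge0 // ?oppr_ge0 // ltW.
Qed.

End Segments.

(** * Drawings by polygons that are straight near the nodes *)
Section Boxes.
Variable R : realFieldType.
Implicit Types a b c d p q : R * R.

(** The maximum distance, for which balls are boxes: two segments in disjoint
    boxes are separated by a horizontal or a vertical line. *)
Definition nearby (s : R) a b := (`|a.1 - b.1| < s) && (`|a.2 - b.2| < s).
Definition far (s : R) a b := (s <= `|a.1 - b.1|) || (s <= `|a.2 - b.2|).

Lemma farNnearby s a b : far s a b = ~~ nearby s a b.
Proof. by rewrite /far /nearby negb_and -!leNgt. Qed.

Lemma nearby_sym s a b : nearby s a b = nearby s b a.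
Proof. by rewrite /nearby !(distrC a.1) !(distrC a.2). Qed.
Lemma far_sym s a b : far s a b = far s b a.
Proof. by rewrite !farNnearby nearby_sym. Qed.

Lemma nearby_refl s a : 0 < s -> nearby s a a.
Proof. by move=> s0; rewrite /nearby !subrr normr0 s0. Qed.

Lemma nearby_le s s' a b : s <= s' -> nearby s a b -> nearby s' a b.
Proof. by move=> ss /andP[h h']; rewrite /nearby !(lt_le_trans _ ss). Qed.
Lemma far_le s s' a b : s' <= s -> far s a b -> far s' a b.
Proof. by move=> ss; rewrite !farNnearby; apply: contraNN; apply: nearby_le. Qed.

Lemma far_neq s a b : 0 < s -> far s a b -> a != b.
Proof. by move=> s0; apply: contraTneq => ->; rewrite farNnearby negbK nearby_refl. Qed.

Lemma boxes_cross0 c d r1 r2 p p' q q' :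
  nearby r1 c p -> nearby r1 c p' -> nearby r2 d q -> nearby r2 d q' ->
  far (r1 + r2) c d -> seg_cross p p' q q' = false.
Proof.
rewrite /nearby !ltr_norml.
move=> /andP[/andP[a1 a2] /andP[b1 b2]] /andP[/andP[a3 a4] /andP[b3 b4]].
move=> /andP[/andP[a5 a6] /andP[b5 b6]] /andP[/andP[a7 a8] /andP[b7 b8]].
rewrite /far !ler_normr -orbA => /or4P[] h.
- by apply: seg_cross_sepx; right; split; lra.
- by apply: seg_cross_sepx; left; split; lra.
- by apply: seg_cross_sepy; right; split; lra.
- by apply: seg_cross_sepy; left; split; lra.
Qed.

Lemma ray_param v p q : same_ray v p q -> p != v -> q != v ->
  exists2 s : R, 0 < s & q.1 - v.1 = s * (p.1 - v.1) /\ q.2 - v.2 = s * (p.2 - v.2).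
Proof.
move=> /andP[/eqP side /eqP ori] pv qv.
have pairE (x y : R * R) : x.1 - y.1 = 0 -> x.2 - y.2 = 0 -> x = y.
  case: x y => [x1 x2] [y1 y2] /= /eqP + /eqP.
  by rewrite !subr_eq0 => /eqP-> /eqP->.
have [s [s1 s2]] : exists s : R, q.1 - v.1 = s * (p.1 - v.1) /\ q.2 - v.2 = s * (p.2
  - v.2).
  move: ori; rewrite /orient => ori.
  have [E|n1] := eqVneq (p.1 - v.1) 0.
    have n2 : p.2 - v.2 != 0 by apply: contraNneq pv => E2; apply/eqP/pairE.
    exists ((q.2 - v.2) / (p.2 - v.2)); rewrite mulfVK //; split=> //.
    rewrite E mulr0; move/eqP: ori; rewrite E mul0r sub0r oppr_eq0 mulf_eq0 (negbTE n2).
    by move/eqP.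
  exists ((q.1 - v.1) / (p.1 - v.1)); rewrite mulfVK //; split=> //.
  move/eqP: ori; rewrite subr_eq0 => /eqP ori.
  by rewrite mulrAC [_ * (p.2 - v.2)]mulrC -ori mulrC mulKf.
exists s => //; have s0 : s != 0.
  by apply: contraNneq qv => E; apply/eqP/pairE; rewrite ?s1 ?s2 E mul0r.
rewrite lt_neqAle eq_sym s0 /= leNgt; apply/negP => sn.
have hp : lexlt v p -> lexlt q v.
  move=> /lexP [h|[E h]]; apply/lexP; first by left;
    rewrite -subr_lt0 s1 nmulr_rlt0 ?subr_gt0.
  right; split; first by apply/eqP; rewrite -subr_eq0 s1 E subrr mulr0.
  by rewrite -subr_lt0 s2 nmulr_rlt0 ?subr_gt0.
have hn : lexlt p v -> lexlt v q.
  move=> /lexP [h|[E h]]; apply/lexP; first by left;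
    rewrite -subr_gt0 s1 nmulr_rgt0 ?subr_lt0.
  right; split; first by apply/eqP; rewrite eq_sym -subr_eq0 s1 E subrr mulr0.
  by rewrite -subr_gt0 s2 nmulr_rgt0 ?subr_lt0.
case: (boolP (lexlt v p)) side => [/hp /lexlt_asym -> //|].
by rewrite (lexlt_total pv) in hn *; move/hn->.
Qed.

(** Two points on one ray from [v] are multiples of each other, hence their
    distance is controlled by the difference of their distances from [v]. *)
Lemma same_ray_nearby v p q rho delta : 0 < delta -> delta <= rho ->
  far rho v p -> far rho v q -> nearby (rho + delta) v p -> nearby (rho + delta) v q ->
  same_ray v p q -> nearby (2 * delta) p q.
Proof.
move=> d0 dr fp fq np nq sr.
have r0 : 0 < rho by apply: lt_le_trans dr.
have pv : p != v by rewrite eq_sym; apply: far_neq fp.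
have qv : q != v by rewrite eq_sym; apply: far_neq fq.
have [s s0 e] := ray_param sr pv qv.
wlog s1 : s s0 p q fp fq np nq sr pv qv e / 1 <= s.
  move=> W; case: (leP 1 s) => [|/ltW] h; first exact: (W s).
  rewrite nearby_sym; apply: (W s^-1) => //; rewrite ?invr_gt0 ?invf_ge1 //.
    move: sr; rewrite /same_ray => /andP[/eqP-> /eqP o]; rewrite eqxx /=.
    have -> : orient v q p = - orient v p q by rewrite /orient; ring.
    by rewrite o oppr0.
  by case: e => -> ->; rewrite !mulKf // gt_eqF.
have E1 : q.1 - p.1 = (s - 1) * (p.1 - v.1) by case: e => e _;
  rewrite mulrBl mul1r -e; ring.
have E2 : q.2 - p.2 = (s - 1) * (p.2 - v.2) by case: e => _ e;
  rewrite mulrBl mul1r -e; ring.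
have s1' : 0 <= s - 1 by rewrite subr_ge0.
have sd : (s - 1) * rho < delta.
  case: e => e1 e2.
  have n1 : s * `|p.1 - v.1| < rho + delta.
    by case/andP: nq => + _; rewrite distrC e1 normrM (gtr0_norm s0).
  have n2 : s * `|p.2 - v.2| < rho + delta.
    by case/andP: nq => _; rewrite distrC e2 normrM (gtr0_norm s0).
  case/orP: fp => h; rewrite distrC in h.
    apply: le_lt_trans (_ : _ <= (s - 1) * `|p.1 - v.1|) _; first exact: ler_wpM2l.
    by rewrite mulrBl mul1r; lra.
  apply: le_lt_trans (_ : _ <= (s - 1) * `|p.2 - v.2|) _; first exact: ler_wpM2l.
  by rewrite mulrBl mul1r; lra.
have s2 : (s - 1) * (rho + delta) < 2 * delta by nra.
rewrite nearby_sym /nearby E1 E2 !normrM !(ger0_norm s1').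
case/andP: np; rewrite (distrC v.1) (distrC v.2) => h1 h2.
by rewrite !(le_lt_trans _ s2) // ler_wpM2l // ltW.
Qed.

End Boxes.

(** The edge [uv] is drawn as the polygon from [pos u] through the points of
    [mid u v] to [pos v].  The middle part stays outside of the boxes of radius
    [rho] around the nodes, its first and last points lie next to those boxes,
    its steps are shorter than [delta], and middle parts of different edges are
    at distance at least [3 * delta].  Nothing prevents a polygon from crossing
    itself. *)
Section Polygons.
Variable R : realFieldType.
Implicit Types (x y : R * R) (l : seq (R * R)).

Fixpoint segs x l : seq ((R * R) * (R * R)) :=
  if l is y :: l' then (x, y) :: segs y l' else [::].

Lemma segs_cat x l l' : segs x (l ++ l') = segs x l ++ segs (last x l) l'.
Proof. by elim: l x => //= y l IH x; rewrite IH. Qed.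

Lemma segs_telescope (F : R * R -> bool) x l :
  \big[addb/false]_(s <- segs x l) (F s.1 (+) F s.2) = F x (+) F (last x l).
Proof.
elim: l x => [|y l IH] x /=; first by rewrite big_nil addbb.
by rewrite big_cons IH /= addbA addbK.
Qed.

Lemma segs_rev (G : R * R -> R * R -> bool) x l : (forall a b, G a b = G b a) ->
  \big[addb/false]_(s <- segs (last x l) (rev (belast x l))) G s.1 s.2 =
  \big[addb/false]_(s <- segs x l) G s.1 s.2.
Proof.
move=> GC; elim: l x => [|y l IH] x /=; first by rewrite /= !big_nil.
rewrite rev_cons -cats1 segs_cat big_cat big_cons IH /=.
have -> : last (last y l) (rev (belast y l)) = y by case: l {IH} => //= z l;
  rewrite rev_cons last_rcons.
by rewrite big_seq1 addbC /= GC.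
Qed.

Lemma segs_mem x l s : s \in segs x l -> (s.1 \in x :: l) && (s.2 \in x :: l).
Proof.
elim: l x => //= y l IH x; rewrite inE => /orP[/eqP->/=|/IH/andP[h1 h2]].
  by rewrite !inE !eqxx orbT.
by rewrite !(in_cons x) h1 h2 !orbT.
Qed.

Lemma segs_nearby d x l s : path (nearby d) x l -> s \in segs x l -> nearby d s.1 s.2.
Proof.
elim: l x => //= y l IH x /andP[h p]; rewrite inE => /orP[/eqP->//|]; exact: IH.
Qed.

Variables (T : finType) (e : rel T) (pos : T -> R * R) (mid : T -> T -> seq (R * R)).
Variables rho delta : R.
Hypothesis e_sym : symmetric e.
Hypothesis e_irr : irreflexive e.
Hypothesis delta_gt0 : 0 < delta.
Hypothesis delta_rho : 3 * delta <= rho.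
Hypothesis pos_far : forall u v, u != v -> far (3 * rho) (pos u) (pos v).
Hypothesis mid_rev : forall u v, mid v u = rev (mid u v).
Hypothesis mid_ne : forall u v, e u v -> mid u v != [::].
Hypothesis mid_step : forall u v, e u v -> sorted (nearby delta) (mid u v).
Hypothesis mid_far : forall u v p, e u v -> p \in mid u v -> far rho (pos u) p.
Hypothesis mid_far2 : forall u v w p, e u v -> p \in mid u v ->
  w != u -> w != v -> far (2 * rho) (pos w) p.
Hypothesis mid_head : forall u v, e u v ->
  nearby (rho + delta) (pos u) (head (pos u) (mid u v)).
Hypothesis mid_apart : forall u v u' v' p q, e u v -> e u' v' ->
  ~~ ((u == u') && (v == v')) -> ~~ ((u == v') && (v == u')) ->
  p \in mid u v -> q \in mid u' v' -> far (3 * delta) p q.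

(** The point towards which the polygon of [uv] leaves [u] straight. *)
Definition hd u v := head (pos u) (mid u v).
Definition msegs u v := segs (hd u v) (behead (mid u v)).
Definition psegs u v := segs (pos u) (rcons (mid u v) (pos v)).

Lemma rho_gt0 : 0 < rho. Proof. by have := delta_gt0; have := delta_rho; lra. Qed.

Lemma mid_cons u v : e u v -> mid u v = hd u v :: behead (mid u v).
Proof. by move=> /mid_ne; rewrite /hd; case: (mid u v). Qed.

Lemma hd_mid u v : e u v -> hd u v \in mid u v.
Proof. by move=> euv; rewrite [X in _ \in X]mid_cons // mem_head. Qed.

Lemma last_hd u v : e u v -> last (hd u v) (behead (mid u v)) = hd v u.
Proof.
move=> euv; have := mid_ne euv; rewrite /hd (mid_rev u v); case: (mid u v) => //= a l _.
by case/lastP: l => [|l b] //=; rewrite last_rcons rev_cons rev_rcons.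
Qed.

Lemma psegs_sum u v (G : R * R -> R * R -> bool) : e u v ->
  (forall a b, G a b = G b a) ->
  \big[addb/false]_(s <- psegs u v) G s.1 s.2 =
  G (pos u) (hd u v) (+) G (pos v) (hd v u) (+)
  \big[addb/false]_(s <- msegs u v) G s.1 s.2.
Proof.
move=> euv GC; rewrite /psegs -cats1 segs_cat big_cat /= big_seq1 /=.
rewrite [in segs _ _](mid_cons euv) /= big_cons /= -/(msegs u v).
rewrite (mid_cons euv) /= last_hd // [G (hd v u) _]GC.
by rewrite addbAC.
Qed.

Lemma psegs_rev u v (G : R * R -> R * R -> bool) : (forall a b, G a b = G b a) ->
  \big[addb/false]_(s <- psegs v u) G s.1 s.2 =
  \big[addb/false]_(s <- psegs u v) G s.1 s.2.
Proof.
move=> GC; rewrite -(segs_rev _ _ GC) last_rcons belast_rcons rev_cons.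
by rewrite /psegs (mid_rev v u).
Qed.

Definition Uform w u v := \big[addb/false]_(s <- psegs u v) side_up (pos w) s.1 s.2.
Definition Dform w u v := \big[addb/false]_(s <- psegs u v) side_dn (pos w) s.1 s.2.

(** Both kinds of contributions of the inner points of a polygon telescope, so
    that the form defined from the nodes counts the crossings of polygons. *)
Lemma crossing_psegs u v u' v' :
  crossing Uform Dform (u, v) (u', v') =
  \big[addb/false]_(s <- psegs u v) \big[addb/false]_(t <- psegs u' v')
    seg_cross s.1 s.2 t.1 t.2.
Proof.
rewrite /seg_cross.
under eq_bigr do rewrite big_split /=.
rewrite big_split /= exchange_big /= /crossing /= /Uform /Dform -!big_split /=.
congr (_ (+) _); apply: eq_bigr => s _.
  by rewrite (segs_telescope (fun p => side_up p s.1 s.2)) last_rcons.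
by rewrite (segs_telescope (fun p => side_dn p s.1 s.2)) last_rcons.
Qed.

Lemma msegs_mid u v s : e u v -> s \in msegs u v ->
  [/\ s.1 \in mid u v, s.2 \in mid u v & nearby delta s.1 s.2].
Proof.
move=> euv sin; have := mid_step euv; rewrite (mid_cons euv) /= => p.
by have /andP[h1 h2] := segs_mem sin; split=> //; apply: segs_nearby sin.
Qed.

Definition same_edge (u v u' v' : T) := ((u == u') && (v == v')) || ((u == v') && (v
  == u')).

Lemma same_edge_sym u v u' v' : same_edge u v u' v' = same_edge u' v' u v.
Proof.
by rewrite /same_edge ![_ == u']eq_sym ![_ == v']eq_sym [(v' == u) && _]andbC.
Qed.

Lemma same_edge_rev u v u' v' : same_edge v u u' v' = same_edge u v u' v'.
Proof. by rewrite /same_edge orbC ![(v == _) && _]andbC. Qed.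

Lemma mid_mid u v u' v' s t : e u v -> e u' v' -> ~~ same_edge u v u' v' ->
  s \in msegs u v -> t \in msegs u' v' -> seg_cross s.1 s.2 t.1 t.2 = false.
Proof.
move=> euv euv' /norP[n1 n2] /(msegs_mid euv)[s1 s2 s12] /(msegs_mid euv')[t1 t2 t12].
have d0 := delta_gt0; apply: (boxes_cross0 (nearby_refl _ d0) s12 (nearby_refl _ d0)
  t12).
by apply: far_le (mid_apart euv euv' n1 n2 s1 t1); lra.
Qed.

Lemma hd_nearby u v : e u v -> nearby (rho + delta) (pos u) (hd u v).
Proof. exact: mid_head. Qed.

Lemma hd_neq u v : e u v -> pos u != hd u v.
Proof.
move=> euv; apply: (far_neq rho_gt0); exact: mid_far (hd_mid euv).
Qed.

(** The segment by which an edge leaves [u] does not fit in a box away from the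
    middle parts of other edges.  Subdivided at [k] it does: the inner part
    stays well inside the box of radius [rho], and the outer part is short. *)
Lemma radial_split u v : e u v -> exists k,
  [/\ on_seg k (pos u) (hd u v), nearby (rho - delta) (pos u) k &
      nearby (2 * delta) (hd u v) k].
Proof.
move=> euv; have d0 := delta_gt0; have dr := delta_rho; have r0 := rho_gt0.
pose c := (rho - delta) / (rho + delta).
have rd : 0 < rho + delta by lra.
have cE : c * (rho + delta) = rho - delta by rewrite mulfVK // gt_eqF.
have c0 : 0 < c by rewrite divr_gt0 //; lra.
have c1 : c < 1 by rewrite ltr_pdivrMr //; lra.
clearbody c.
pose k := ((pos u).1 + c * ((hd u v).1 - (pos u).1), (pos u).2 + c * ((hd u v).2 -
  (pos u).2)).
have /andP[n1 n2] := hd_nearby euv; rewrite distrC in n1; rewrite distrC in n2.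
exists k; split; first by exists c; rewrite ?c0.
  have e1 : k.1 - (pos u).1 = c * ((hd u v).1 - (pos u).1) by rewrite /k /=; ring.
  have e2 : k.2 - (pos u).2 = c * ((hd u v).2 - (pos u).2) by rewrite /k /=; ring.
  rewrite nearby_sym /nearby e1 e2 !normrM !(gtr0_norm c0) -cE.
  by rewrite !ltr_pM2l // n1 n2.
have c1' : 0 < 1 - c by lra.
have e1 : (hd u v).1 - k.1 = (1 - c) * ((hd u v).1 - (pos u).1) by rewrite /k /=; ring.
have e2 : (hd u v).2 - k.2 = (1 - c) * ((hd u v).2 - (pos u).2) by rewrite /k /=; ring.
have e3 : 2 * delta = (1 - c) * (rho + delta) by rewrite mulrBl mul1r cE; ring.
by rewrite /nearby e1 e2 !normrM !(gtr0_norm c1') e3 !ltr_pM2l // n1 n2.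
Qed.

(** An edge that is not incident with [u] stays far from the whole segment; for
    an edge incident with [u] the subdivision is needed. *)
Lemma rad_mid u v u' v' t : e u v -> e u' v' -> ~~ same_edge u v u' v' ->
  t \in msegs u' v' -> seg_cross (pos u) (hd u v) t.1 t.2 = false /\
    seg_cross t.1 t.2 (pos u) (hd u v) = false.
Proof.
move=> euv euv' ne tin; have [t1 t2 t12] := msegs_mid euv' tin.
have d0 := delta_gt0; have dr := delta_rho; have r0 := rho_gt0.
have rd : 0 < rho + delta by lra.
have rmd : 0 < rho - delta by lra.
have d20 : 0 < 2 * delta by lra.
have ft p : u \in [:: u'; v'] -> p \in mid u' v' -> far rho (pos u) p.
  rewrite !inE => /orP[/eqP->|/eqP->] pin; first exact: mid_far pin.
  by apply: (@mid_far v' u'); rewrite 1?e_sym // mid_rev mem_rev.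
have box c r : 0 < r -> nearby r c (pos u) -> nearby r c (hd u v) ->
  far (r + delta) c t.1 ->
    seg_cross (pos u) (hd u v) t.1 t.2 = false /\ seg_cross t.1 t.2 (pos u) (hd u v)
      = false.
  move=> _ h1 h2 f; split.
    exact: (boxes_cross0 h1 h2 (nearby_refl _ d0) t12).
  by apply: (boxes_cross0 (nearby_refl _ d0) t12 h1 h2); rewrite far_sym addrC.
case: (boolP (u \in [:: u'; v'])) => [uin|]; last first.
  rewrite !inE negb_or => /andP[uu uv]; have f := mid_far2 euv' t1 uu uv.
  apply: (box (pos u) (rho + delta)) => //; [exact: nearby_refl|exact: hd_nearby|].
  by apply: far_le f; lra.
have [k [kon ku kh]] := radial_split euv.
have kt p : p \in mid u' v' -> p != k.
  move=> /(ft _ uin); rewrite farNnearby; apply: contraNneq => ->.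
  by apply: nearby_le ku; lra.
have f1 := ft _ uin t1.
case/norP: ne => ne1 ne2.
have f2 := mid_apart euv euv' ne1 ne2 (hd_mid euv) t1.
rewrite (seg_cross_splitl _ _ kon (hd_neq euv)) (seg_cross_splitr kon (hd_neq euv))
  ?kt //.
rewrite (boxes_cross0 (nearby_refl _ _) ku (nearby_refl _ d0) t12) ?subrK //.
rewrite (boxes_cross0 kh (nearby_refl _ _) (nearby_refl _ d0) t12) //;
  last by apply: far_le f2; lra.
rewrite (boxes_cross0 (nearby_refl _ d0) t12 (nearby_refl _ _) ku) //; last first.
  by rewrite addrC subrK far_sym.
rewrite (boxes_cross0 (nearby_refl _ d0) t12 kh (nearby_refl _ _)) //.
by rewrite far_sym; apply: far_le f2; lra.
Qed.

Lemma rad_rad u v u' v' : e u v -> e u' v' -> u != u' ->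
  seg_cross (pos u) (hd u v) (pos u') (hd u' v') = false.
Proof.
move=> euv euv' uu.
have d0 := delta_gt0; have dr := delta_rho; have r0 := rho_gt0.
have rd : 0 < rho + delta by lra.
apply: (boxes_cross0 (nearby_refl _ rd) (hd_nearby euv) (nearby_refl _ rd) (hd_nearby
  euv')).
by apply: far_le (pos_far uu); lra.
Qed.

Lemma hd_same_ray u v w : e u v -> e u w -> v != w ->
  ~~ same_ray (pos u) (hd u v) (hd u w).
Proof.
move=> euv euw vw; have d0 := delta_gt0; have dr := delta_rho; have r0 := rho_gt0.
have dr' : delta <= rho by lra.
apply/negP => sr.
have n := same_ray_nearby d0 dr' (mid_far euv (hd_mid euv)) (mid_far euw (hd_mid euw))
  (hd_nearby euv) (hd_nearby euw) sr.
have uw : u != w by apply: contraTneq euw => <-; rewrite e_irr.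
have := mid_apart euv euw _ _ (hd_mid euv) (hd_mid euw).
rewrite (negbTE vw) (negbTE uw) andbF => /(_ isT isT); rewrite farNnearby => /negP;
  apply.
by apply: nearby_le n; lra.
Qed.

Lemma rad_rad_same u v w : e u v -> e u w -> v != w ->
  seg_cross (pos u) (hd u v) (pos u) (hd u w) = angle_lt (pos u) (hd u v) (hd u w).
Proof.
move=> euv euw vw; apply: seg_cross_angle; rewrite 1?eq_sym ?hd_neq //.
exact: hd_same_ray.
Qed.

(** All crossings of different edges take place between the first or last
    segments of the polygons. *)
Lemma crossing_radials u v u' v' : e u v -> e u' v' -> ~~ same_edge u v u' v' ->
  crossing Uform Dform (u, v) (u', v') =
  (seg_cross (pos u) (hd u v) (pos u') (hd u' v') (+)
   seg_cross (pos u) (hd u v) (pos v') (hd v' u')) (+)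
  (seg_cross (pos v) (hd v u) (pos u') (hd u' v') (+)
   seg_cross (pos v) (hd v u) (pos v') (hd v' u')).
Proof.
move=> euv euv' ne; rewrite crossing_psegs.
have evu : e v u by rewrite e_sym.
have evu' : e v' u' by rewrite e_sym.
have neC : ~~ same_edge u' v' u v by rewrite same_edge_sym.
have neR : ~~ same_edge v u u' v' by rewrite same_edge_rev.
have neCR : ~~ same_edge v' u' u v by rewrite same_edge_rev.
have sub a b : \big[addb/false]_(t <- psegs u' v') seg_cross a b t.1 t.2 =
   seg_cross a b (pos u') (hd u' v') (+) seg_cross a b (pos v') (hd v' u') (+)
   \big[addb/false]_(t <- msegs u' v') seg_cross a b t.1 t.2.
  by apply: psegs_sum => // *; apply: seg_crossCr.
rewrite (psegs_sum (G := fun a b =>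
  \big[addb/false]_(t <- psegs u' v') seg_cross a b t.1 t.2)) //; last first.
  by move=> a b; apply: eq_bigr => t _; apply: seg_crossCl.
have -> : \big[addb/false]_(s <- msegs u v)
    \big[addb/false]_(t <- psegs u' v') seg_cross s.1 s.2 t.1 t.2 = false.
  rewrite big_seq big1 // => s sin; rewrite sub.
  rewrite (rad_mid euv' euv neC sin).2 (rad_mid evu' euv neCR sin).2.
  by rewrite big_seq big1 // => t tin; apply: mid_mid sin tin.
have zero a b : e a b -> ~~ same_edge a b u' v' ->
    \big[addb/false]_(t <- msegs u' v') seg_cross (pos a) (hd a b) t.1 t.2 = false.
  by move=> eab nab; rewrite big_seq big1 // => t tin;
    apply: (rad_mid eab euv' nab tin).1.
by rewrite !sub !zero // !addbF.
Qed.

Definition mid_lt (x y z : T) := angle_lt (pos x) (hd x y) (hd x z).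

Theorem polygons_crossing_form : crossing_form e Uform Dform mid_lt.
Proof.
split; first split.
- by move=> w x y; apply: psegs_rev => a b; apply: side_upC.
- by move=> w x y; apply: psegs_rev => a b; apply: side_dnC.
- move=> x y x' y' exy exy' n1 n2 n3 n4; have eyx : e y x by rewrite e_sym.
  have eyx' : e y' x' by rewrite e_sym.
  by rewrite crossing_radials ?rad_rad // /same_edge negb_or !negb_and n1 n2.
- move=> x y z exy exz yz; have eyx : e y x by rewrite e_sym.
  have ezx : e z x by rewrite e_sym.
  have ne a b : e a b -> a != b by apply: contraTneq => ->; rewrite e_irr.
  rewrite crossing_radials //;
    last by rewrite /same_edge negb_or !negb_and yz orbT (ne _ _ exz).
  rewrite (rad_rad exy ezx (ne _ _ exz)) (rad_rad eyx exz (ne _ _ eyx)) (rad_rad eyx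
    ezx yz).
  by rewrite !addbF; apply: rad_rad_same.
- move=> x y z exy exz yz; apply: angle_lt_anti; exact: hd_same_ray.
- move=> x y z t exy exz ext yz zt yt; apply: angle_lt_trans.
  all: rewrite 1?eq_sym ?hd_neq //; exact: hd_same_ray.
Qed.

End Polygons.

(** * From a drawing by arcs to a drawing by polygons *)
Section Topology.
Variable R : realType.
Local Notation plane := (R * R)%type.
Lemma nearbyP s (a b : plane) : nearby s a b <-> ball a s b.
Proof.
rewrite /nearby /ball /= /prod_ball -!ball_normE /=.
by split=> [/andP[]|[-> ->]].
Qed.

Lemma nearby_trans s s' (a b c : plane) : nearby s a b -> nearby s' b c ->
  nearby (s + s') a c.
Proof. by move=> /nearbyP h1 /nearbyP h2; apply/nearbyP;
  apply: ball_triangle h1 h2. Qed.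

Lemma closed_far s (a : plane) : closed [set p | far s a p].
Proof.
have -> : [set p | far s a p] = ~` ball a s.
  apply/seteqP; split=> p /=; first by rewrite farNnearby => /negP h /nearbyP.
  by move=> h; rewrite farNnearby; apply/negP => /nearbyP.
exact/open_closedC/ball_open.
Qed.

Lemma compact_apart (K B : set plane) : compact K -> closed B ->
  (forall p, K p -> B p -> False) ->
  exists2 s : R, 0 < s & forall a b, K a -> B b -> far s a b.
Proof.
move=> /compact_near_coveringP cK cB KB.
have h : \forall s \near 0^'+, K `<=` [set a | forall b, B b -> far s a b].
  apply: (cK R 0^'+ (fun s a => forall b, B b -> far s a b)) => a Ka.
  have nBa : ~ B a by move/(KB _ Ka).
  have : nbhs a (~` B) by apply: open_nbhs_nbhs; split=> //; exact: closed_openC.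
  case/nbhs_ballP => d /= d0 sub.
  have d20 : 0 < d / 2 by rewrite divr_gt0.
  exists (ball a (d / 2), [set s : R | s < d / 2]).
    split=> /=; first exact: nbhsx_ballx.
    exact: nbhs_right_lt.
  move=> [a' s] /= [aa' sd] b Bb; rewrite farNnearby; apply/negP => nr.
  have := sub b; apply => //; rewrite (splitr d).
  apply: ball_triangle aa' _; apply/nearbyP.
  by apply: nearby_le nr; apply: ltW.
near (0 : R)^'+ => s.
have s0 : 0 < s by near: s; exact: nbhs_right_gt.
exists s => // a b Ka; move: a Ka b; near: s; exact: h.
Unshelve. all: by end_near.
Qed.

Lemma fin_eps (I : finType) (P : I -> R -> Prop) :
  (forall i a b, a <= b -> P i b -> P i a) ->
  (forall i, exists2 s, 0 < s & P i s) ->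
  exists2 s, 0 < s & forall i, P i s.
Proof.
move=> mono ex.
have [s s0 sP] : exists2 s : R, 0 < s & forall i, i \in enum I -> P i s.
  elim: (enum I) => [|i l [s s0 IH]]; first by exists 1.
  have [t t0 tP] := ex i; exists (Num.min s t); first by rewrite lt_min s0.
  move=> j; rewrite inE => /orP[/eqP->|/IH h]; first by apply: mono tP;
    rewrite ge_min lexx orbT.
  by apply: mono h; rewrite ge_min lexx.
by exists s => // i; apply: sP; rewrite mem_enum.
Qed.

(** The points that can be reached from [a] in steps shorter than [d] form an
    open and closed subset. *)
Lemma connected_chain (I : set plane) (d : R) (a b : plane) :
  connected I -> 0 < d -> I a -> I b ->
  exists s : seq plane, [/\ path (nearby d) a s, last a s = b & forall p, p \in s ->
    I p].
Proof.
move=> cI d0 Ia Ib.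
pose B := [set p | I p /\ exists s : seq plane, [/\ path (nearby d) a s, last a s = p &
   forall q, q \in s -> I q]].
have step p q : B p -> I q -> nearby d p q -> B q.
  case=> Ip [s [ps ls sI]] Iq npq; split=> //; exists (rcons s q); split.
  - by rewrite rcons_path ps ls.
  - by rewrite last_rcons.
  - by move=> z; rewrite mem_rcons inE => /orP[/eqP->//|/sI].
suff : B = I by move=> E; have : B b by [rewrite E]; case=> _ [s h]; exists s.
have opn (C : set plane) : open (\bigcup_(p in C) ball p d).
  by apply: bigcup_open => p _; exact: ball_open.
apply: cI.
- by exists a; split=> //; exists [::]; split.
- exists (\bigcup_(p in B) ball p d) => //; apply/seteqP; split=> p.
    move=> Bp; split; first by case: Bp.
    by exists p => //; apply: ballxx.
  by case=> Ip [q Bq /nearbyP]; apply: step.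
- exists (~` \bigcup_(p in I `\` B) ball p d); first exact: open_closedC.
  apply/seteqP; split=> p.
    move=> Bp; split; first by case: Bp.
    by case=> q [Iq nBq] /nearbyP npq; apply: nBq; apply: step Bp Iq _;
      rewrite nearby_sym.
  case=> Ip nO; apply: contrapT => nBp; apply: nO; exists p => //; exact: ballxx.
Qed.

(** A chain of small steps from near [u] to near [v] contains a stretch that runs
    from a visit of the box of [u] to a visit of the box of [v] and stays outside
    of both boxes in between.  The second alternative describes a chain that
    starts outside of the boxes, for which the stretch may already have begun. *)
Lemma middle_chain (d r : R) (I : set plane) (u v x : plane) (s : seq plane) :
  0 < d -> d <= r -> far (3 * r) u v -> path (nearby d) x s ->
  (forall p, p \in x :: s -> I p) -> nearby r v (last x s) ->
  let good m := [/\ m != [::], sorted (nearby d) m,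
     forall p, p \in m -> [/\ I p, far r u p & far r v p],
     nearby (r + d) u (head u m) & nearby (r + d) v (last u m)] in
  (nearby r u x -> exists m, good m) /\
  (~~ nearby r u x -> nearby r v x \/ (exists m, good m) \/
     exists m, [/\ path (nearby d) x m, forall p, p \in x :: m ->
       [/\ I p, far r u p & far r v p]
       & nearby (r + d) v (last x m)]).
Proof.
move=> d0 dr fuv + + + good.
have disj p q : nearby r u p -> nearby d p q -> nearby r v q -> False.
  move=> h1 h2 h3; have := nearby_trans (nearby_trans h1 h2) _;
    rewrite nearby_sym in h3.
  move=> /(_ _ _ h3) h; move: fuv; rewrite farNnearby => /negP; apply.
  by apply: nearby_le h; lra.
have tr q b : nearby d b q -> nearby r v b -> nearby (r + d) v q.
  by move=> h1 h2; apply: nearby_trans h2 h1.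
elim: s x => [|y s IH] x /=.
  move=> _ _ h; split; last by left.
  by move=> h'; case: (disj x x) => //; apply: nearby_refl.
move=> /andP[xy ps] sI lv.
have [IH1 IH2] := IH y ps (fun p h => sI p (mem_behead (s := x :: y :: s) h)) lv.
have Ix : I x by apply: sI; rewrite mem_head.
split=> [ux|nux].
  case: (boolP (nearby r u y)) => [/IH1//|/IH2]; case=> [vy|];
    first by case: (disj x y).
  case=> [//|[m [pm mI lm]]]; exists (y :: m); split=> //=.
  exact: nearby_trans ux xy.
case: (boolP (nearby r v x)) => nvx; [by left|right].
case: (boolP (nearby r u y)) => [/IH1|/IH2]; first by left.
case=> [vy|[?|[m [pm mI lm]]]]; [right|by left|right].
  exists [::]; split=> //=.
    by move=> p; rewrite inE => /eqP->; rewrite !farNnearby.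
  by apply: tr vy; rewrite nearby_sym.
exists (y :: m); split=> //=; first by rewrite xy.
by move=> p; rewrite inE => /orP[/eqP->|/mI//]; rewrite !farNnearby.
Qed.


Section Drawing.
Variables (T : finType) (e : rel T) (pos : T -> plane) (arc : T -> T -> R -> plane).
Hypothesis e_sym : symmetric e.
Hypothesis e_irr : irreflexive e.
Hypothesis drawn : plane_drawing e pos arc.

Definition img u v := arc u v @` `[0, 1].
(** The part of the arc outside of the boxes around its ends.  Distinct arcs may
    approach each other only at common ends, hence these parts are compact and
    disjoint. *)
Definition core r u v :=
  img u v `&` ([set p | far r (pos u) p] `&` [set p | far r (pos v) p]).

Let pos_inj : injective pos. Proof. by case: drawn. Qed.

Lemma img_compact u v : e u v -> compact (img u v).
Proof.
case: drawn => _ h _ _ /h[c _ _ _ _]; apply: continuous_compact => //.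
exact: segment_compact.
Qed.

Lemma img_connected u v : e u v -> connected (img u v).
Proof.
case: drawn => _ h _ _ /h[c _ _ _ _]; apply: connected_continuous_connected => //.
exact: segment_connected.
Qed.

Lemma img_l u v : e u v -> img u v (pos u).
Proof.
case: drawn => _ h _ _ /h[_ _ <- _ _]; exists 0 => //=.
by rewrite in_itv /= lexx ler01.
Qed.

Lemma img_r u v : e u v -> img u v (pos v).
Proof.
case: drawn => _ h _ _ /h[_ _ _ <- _]; exists 1 => //=.
by rewrite in_itv /= lexx ler01.
Qed.

Lemma img_sym u v p : e u v -> img u v p -> img v u p.
Proof.
move=> euv; have evu : e v u by rewrite e_sym.
case: drawn => _ h _ _ [t t01 <-]; have [_ _ _ _ ->] := h _ _ evu; last first.
  exact: t01.
exists (1 - t) => //=; move: t01; rewrite /= !in_itv /= => /andP[t0 t1].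
by rewrite subr_ge0 t1 lerBlDr lerDl.
Qed.

Lemma img_inner u v p : e u v -> img u v p -> p <> pos u -> p <> pos v ->
  exists2 t, t \in `]0, 1[ & arc u v t = p.
Proof.
case: drawn => _ h _ _ /h[_ _ a0 a1 _] [t /=]; rewrite in_itv /= =>
  /andP[t0 t1] <- n0 n1.
exists t => //; rewrite in_itv /= !lt_neqAle t0 t1 !andbT; apply/andP; split.
  by apply: contra_notN n0 => /eqP <-.
by apply: contra_notN n1 => /eqP ->.
Qed.

Lemma img_vertex u v w : e u v -> w != u -> w != v -> ~ img u v (pos w).
Proof.
move=> euv wu wv ip; have [||t t01 E] := img_inner euv ip.
- by move/pos_inj => E; rewrite E eqxx in wu.
- by move/pos_inj => E; rewrite E eqxx in wv.
by case: drawn => _ _ h _; apply: (h u v w t).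
Qed.

Lemma core_compact r u v : e u v -> compact (core r u v).
Proof.
move=> euv; apply: compact_closedI; first exact: img_compact.
apply: closedI; exact: closed_far.
Qed.

Lemma core_disjoint r u v u' v' p : 0 < r -> e u v -> e u' v' ->
  ~~ same_edge u v u' v' ->
  core r u v p -> core r u' v' p -> False.
Proof.
move=> r0 euv euv' ne [i [/= fu fv]] [i' [/= fu' fv']].
have nn w : far r (pos w) p -> p <> pos w.
  by move=> /(far_neq r0)/eqP h E; apply: h.
have [t t01 E] := img_inner euv i (nn _ fu) (nn _ fv).
have [t' t01' E'] := img_inner euv' i' (nn _ fu') (nn _ fv').
case: drawn => _ _ _ h; have := h _ _ _ _ _ _ euv euv' t01 t01'; rewrite E E' =>
  /(_ erefl).
by move: ne; rewrite /same_edge => /norP[n1 n2] [[E1 E2]|[E1 E2]];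
  [move: n1|move: n2]; rewrite E1 E2 !eqxx.
Qed.

(** A radius of boxes that keeps different nodes, and nodes and edges that are not
    incident, well apart. *)
Lemma drawing_rho : exists2 rho, 0 < rho &
  (forall u v, u != v -> far (3 * rho) (pos u) (pos v)) /\
  (forall u v w p, e u v -> w != u -> w != v -> img u v p -> far (2 * rho) (pos w) p).
Proof.
have fmono a b c x y : 0 < c -> a <= b -> far (c * b) x y -> far (c * a) x y :> bool.
  by move=> c0 ab; apply: far_le; rewrite ler_pM2l.
have [r1 r10 h1] : exists2 r, 0 < r & forall uv : T * T, uv.1 != uv.2 ->
    far (3 * r) (pos uv.1) (pos uv.2).
  apply: (fin_eps (P := fun (uv : T * T) r => uv.1 != uv.2 ->
    far (3 * r) (pos uv.1) (pos uv.2))).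
    by move=> uv a b ab h /h; apply: fmono.
  move=> [u v] /=; case: (eqVneq u v) => [->|uv]; first by exists 1.
  have [|||s s0 h] := @compact_apart [set pos u] [set pos v].
  - exact: compact_set1.
  - apply: compact_closed; [exact: norm_hausdorff|exact: compact_set1].
  - by move=> p -> /pos_inj E; rewrite E eqxx in uv.
  exists (s / 3); first by rewrite divr_gt0.
  by move=> _; rewrite mulrC divfK ?pnatr_eq0 //; apply: h.
have [r2 r20 h2] : exists2 r, 0 < r & forall x : T * T * T, e x.1.1 x.1.2 ->
    x.2 != x.1.1 -> x.2 != x.1.2 -> forall p, img x.1.1 x.1.2 p ->
      far (2 * r) (pos x.2) p.
  apply: (fin_eps (P := fun (x : T * T * T) r => e x.1.1 x.1.2 ->
    x.2 != x.1.1 -> x.2 != x.1.2 -> forall p, img x.1.1 x.1.2 p ->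
      far (2 * r) (pos x.2) p)).
    by move=> uv a b ab h euv n1 n2 p /(h euv n1 n2); apply: fmono.
  move=> [[u v] w] /=; case: (boolP (e u v)) => [euv|_]; last by exists 1.
  case: (eqVneq w u) => [_|wu]; first by exists 1.
  case: (eqVneq w v) => [_|wv]; first by exists 1.
  have [|||s s0 h] := @compact_apart [set pos w] (img u v).
  - exact: compact_set1.
  - apply: compact_closed; [exact: norm_hausdorff|exact: img_compact].
  - by move=> p -> /(img_vertex euv wu wv).
  exists (s / 2); first by rewrite divr_gt0.
  by move=> _ _ _ p ip; rewrite mulrC divfK ?pnatr_eq0 //; apply: h.
exists (Num.min r1 r2); first by rewrite lt_min r10.
split=> [u v uv|u v w p euv wu wv ip].
  by apply: far_le (h1 (u, v) uv); rewrite ler_pM2l // ge_min lexx.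
by apply: far_le (h2 (u, v, w) euv wu wv p ip); rewrite ler_pM2l // ge_min lexx orbT.
Qed.

Lemma drawing_eta rho : 0 < rho -> exists2 eta, 0 < eta &
  forall u v u' v' p q, e u v -> e u' v' -> ~~ same_edge u v u' v' ->
    core rho u v p -> core rho u' v' q -> far eta p q.
Proof.
move=> r0.
pose P (x : T * T * (T * T)) s := e x.1.1 x.1.2 -> e x.2.1 x.2.2 ->
   ~~ same_edge x.1.1 x.1.2 x.2.1 x.2.2 -> forall p q, core rho x.1.1 x.1.2 p ->
   core rho x.2.1 x.2.2 q -> far s p q.
suff [s s0 h] : exists2 s, 0 < s & forall x, P x s.
  exists s => // u v u' v' p q e1 e2 n c1 c2;
    exact: (h (u, v, (u', v')) e1 e2 n p q c1 c2).
apply: fin_eps => [x a b ab h e1 e2 n p q c1 c2|].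
  exact: far_le (h e1 e2 n p q c1 c2).
move=> [[u v] [u' v']]; rewrite /P /=.
case: (boolP (e u v)) => [e1|_]; last by exists 1.
case: (boolP (e u' v')) => [e2|_]; last by exists 1.
case: (boolP (same_edge u v u' v')) => [_|n]; first by exists 1.
have [|||s s0 h] := @compact_apart (core rho u v) (core rho u' v').
- exact: core_compact.
- apply: compact_closed; [exact: norm_hausdorff|exact: core_compact].
- by move=> p; apply: core_disjoint.
by exists s => // _ _ _ p q; apply: h.
Qed.

(** Any drawing by arcs, however wild near the nodes, yields a crossing form:
    outside of small boxes the arcs are replaced by chains of small steps, and
    inside by straight segments towards the nodes. *)
Theorem drawing_crossing_form : exists U D lt, crossing_form e U D lt.
Proof.
have [rho r0 [pos_far img_far]] := drawing_rho.
have [eta eta0 apart] := drawing_eta r0.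
pose d := Num.min rho eta / 3.
have m0 : 0 < Num.min rho eta by rewrite lt_min r0.
have d0 : 0 < d by rewrite divr_gt0.
have d3 : 3 * d = Num.min rho eta by rewrite mulrC divfK ?pnatr_eq0.
have dr : 3 * d <= rho by rewrite d3 ge_min lexx.
have de : 3 * d <= eta by rewrite d3 ge_min lexx orbT.
have irr u v : e u v -> u != v by apply: contraTneq => ->; rewrite e_irr.
pose good u v m := [/\ m != [::], sorted (nearby d) m, forall p, p \in m ->
  core rho u v p,
   nearby (rho + d) (pos u) (head (pos u) m) & nearby (rho + d) (pos v) (last (pos u)
     m)].
have ex (uv : T * T) : exists m, e uv.1 uv.2 -> good uv.1 uv.2 m.
  case: uv => u v /=; case: (boolP (e u v)) => [euv|_]; last by exists [::].
  have [s [ps ls sI]] := connected_chain (img_connected euv) d0 (img_l euv) (img_r euv).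
  have [|||||h _] := @middle_chain d rho (img u v) (pos u) (pos v) (pos u) s d0.
  - by lra.
  - by apply: pos_far; apply: irr.
  - by [].
  - by move=> p; rewrite inE => /orP[/eqP->|/sI//]; apply: img_l.
  - by rewrite ls; apply: nearby_refl.
  have [m [m1 m2 m3 m4 m5]] := h (nearby_refl _ r0).
  exists m => _; split=> // p /m3[ip fu fv]; by split.
have [m0f mP] := choice ex.
(* The chains for uv and vu are chosen independently; one of them is reversed
   to serve both. *)
pose mid u v := if e u v then
   (if (enum_rank u < enum_rank v)%N then m0f (u, v) else rev (m0f (v, u))) else [::].
have midP u v : e u v -> good u v (mid u v).
  move=> euv; rewrite /mid euv; case: ifP => _; first exact: (mP (u, v)).
  have evu : e v u by rewrite e_sym.
  have [m1 m2 m3 m4 m5] := mP (v, u) evu; split.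
  - by move: m1; rewrite -!size_eq0 size_rev.
  - by rewrite rev_sorted; apply: sub_sorted m2 => a b; rewrite nearby_sym.
  - move=> p; rewrite mem_rev => /m3 /= [ip [fv fu]]; split=> //; exact: img_sym.
  - move: m1 m5; case/lastP: (m0f _) => //= l b _; by rewrite last_rcons rev_rcons.
  - by move: m1 m4; case: (m0f _) => //= b l _; rewrite rev_cons last_rcons.
exists (Uform pos mid), (Dform pos mid), (mid_lt pos mid).
apply: (@polygons_crossing_form R T e pos mid rho d) => //.
- move=> u v; rewrite /mid e_sym; case: ifP => // evu.
  have := irr _ _ evu; rewrite -(inj_eq enum_rank_inj) -(inj_eq val_inj) neq_ltn.
  by move=> /orP[h|h]; rewrite h ltnNge (ltnW h) /= ?revK.
- by move=> u v /midP[].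
- by move=> u v /midP[].
- by move=> u v p /midP[_ _ h _ _] /h [_ [fu _]].
- move=> u v w p euv /(let: And5 _ _ h _ _ := midP u v euv in h p) [ip _] wu wv.
  exact: img_far ip.
- by move=> u v /midP[].
- move=> u v u' v' p q euv euv' n1 n2 pm qm.
  apply: far_le de _; apply: (apart u v u' v') => //.
  + by rewrite /same_edge negb_or n1.
  + by have [_ _ h _ _] := midP _ _ euv; apply: h.
  + by have [_ _ h _ _] := midP _ _ euv'; apply: h.
Qed.

End Drawing.
End Topology.

(** * Balls in a connected graph *)
Section Balls.
Variables (V : choiceType) (e : rel V) (x0 : V).
Hypothesis e_connected : connected_graph e.

Lemma gdistP x y : has_walk e x y (gdist e x y).
Proof.
rewrite /gdist; case: pselect => [h|[]]; first by case: ex_minnP => m /asboolP.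
have [p ep lp] := e_connected x y; exists (size p); apply/asboolP; by exists p.
Qed.

Lemma gdist_min x y k : has_walk e x y k -> (gdist e x y <= k)%N.
Proof.
rewrite /gdist => w; case: pselect => [h|//]; case: ex_minnP => m _; apply.
exact/asboolP.
Qed.

Lemma gdist0 x : gdist e x x = 0%N.
Proof. by apply/eqP; rewrite -leqn0; apply: gdist_min; exists [::]. Qed.

Lemma gdist_eq0 y : gdist e x0 y = 0%N -> y = x0.
Proof. by move=> E; have := gdistP x0 y; rewrite E => -[p [_ <- /size0nil->]]. Qed.

Lemma gdist_step x y : e x y -> (gdist e x0 y <= (gdist e x0 x).+1)%N.
Proof.
move=> exy; have [p [ep lp sp]] := gdistP x0 x; apply: gdist_min.
by exists (rcons p y); rewrite rcons_path ep lp exy last_rcons size_rcons sp.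
Qed.

Lemma gdist_pred y : y != x0 -> exists2 z, e z y & gdist e x0 y = (gdist e x0 z).+1.
Proof.
move=> yx; have [p [+ + E]] := gdistP x0 y.
case/lastP: p E => [E _ /= E'|p y' E]; first by rewrite E' eqxx in yx.
rewrite rcons_path last_rcons => /andP[ep ey] ?; subst y'; exists (last x0 p) => //.
apply/eqP; rewrite eqn_leq gdist_step //= -E size_rcons ltnS; apply: gdist_min.
by exists p.
Qed.

Lemma gball_finite n : locally_finite_graph e -> finite_set (gball e x0 n).
Proof.
move=> lf; elim: n => [|n IH].
  apply: (sub_finite_set _ (finite_set1 x0)) => y /=; rewrite /gball /= leqn0 => /eqP.
  exact: gdist_eq0.
apply: (@sub_finite_set _ _ ([set x0] `|` \bigcup_(z in gball e x0 n) [set y | e z y])).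
  move=> y; rewrite /gball /= => h; have [->|yx] := eqVneq y x0; [by left|right].
  have [z ezy E] := gdist_pred yx; exists z => //=.
  by rewrite /gball /= -ltnS -E.
rewrite finite_setU; split; first exact: finite_set1.
by apply: bigcup_finite.
Qed.

End Balls.

(** The separator applied to a breadth-first tree of the ball, the root paths of
    which have at most [n.+1] nodes.  Separation is stated for whole walks that
    avoid [X]. *)
Lemma ball_separator (R : realType) (V : choiceType) (e : rel V) (x0 : V) (n : nat) :
  simple_graph e -> connected_graph e -> locally_finite_graph e -> planar R e ->
  (7 <= gball_size e x0 n)%N ->
  exists X In Out : seq V,
  [/\ (0 < size X <= 2 * n.+1)%N, uniq In /\ uniq Out,
      (gball_size e x0 n <= 3 * (size In + size X))%N /\
      (gball_size e x0 n <= 3 * (size Out + size X))%N,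
      (forall v, v \in X -> gball e x0 n v) /\
      (forall v, v \in In -> gball e x0 n v) /\
      (forall v, v \in Out -> gball e x0 n v) &
      (forall v, v \in In -> v \notin Out) /\
      forall x p, path e x p -> (forall z, z \in x :: p -> gball e x0 n z) ->
        (forall z, z \in x :: p -> z \notin X) ->
        ((x \in In) = (last x p \in In)) /\ ((x \in Out) = (last x p \in Out))].
Proof.
move=> [e_sym e_irr] e_conn lf [pos [arc [pinj harc hvert hcross]]].
set A := gball e x0 n; have Afin : finite_set A by apply: gball_finite.
rewrite /gball_size -/A; set W := fset_set A => W7.
have WA v : (v \in W) = (v \in A) by rewrite in_fset_set.
have inW v : A v -> v \in W by move=> Av; rewrite WA inE.
have Win v : v \in W -> A v by rewrite WA inE.
pose T : finType := W; pose eT : rel T := fun x y => e (val x) (val y).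
have x0W : x0 \in W by apply: inW; rewrite /A /gball /= gdist0.
pose r : T := [` x0W]%fset.
pose depth (x : T) := gdist e x0 (val x).
have depthn x : (depth x <= n)%N by have /Win := valP x.
have ex (x : T) : exists y : T, x != r -> eT x y /\ depth x = (depth y).+1.
  case: (eqVneq x r) => [_|xr]; first by exists x.
  have xr' : val x != x0 by apply: contraNneq xr => E; apply/eqP/val_inj.
  have [z ez E] := gdist_pred e_conn xr'.
  have zW : z \in W.
    apply: inW; rewrite /A /gball /=; have := depthn x; rewrite /depth E; exact: ltnW.
  by exists [` zW]%fset => _; rewrite /eT /= e_sym.
have [par parP] := choice ex.
have eT_sym : symmetric eT by move=> x y; apply: e_sym.
have eT_irr : irreflexive eT by move=> x; apply: e_irr.
have drawn : @plane_drawing R T eT (fun x => pos (val x)) (fun x y =>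
  arc (val x) (val y)).
  split.
  - by move=> x y /pinj/val_inj.
  - by move=> x y /harc.
  - by move=> x y z t exy; apply: hvert.
  - move=> x y x' y' s t exy exy' s01 t01 E.
    have [[/val_inj-> /val_inj->]|[/val_inj-> /val_inj->]] := hcross _ _ _ _ _ _ exy
      exy' s01 t01 E.
      by left.
    by right.
have [U [D [lt form]]] := drawing_crossing_form eT_sym eT_irr drawn.
have par_e x : x != r -> eT x (par x) by move/parP => [].
have depth_par x : x != r -> depth x = (depth (par x)).+1 by move/parP => [].
have depth_r : depth r = 0%N by apply: gdist0.
have T7 : (7 <= #|T|)%N by rewrite -cardfE.
have := tree_separator eT_sym eT_irr par_e depth_par depth_r form T7.
move=> [a [b [I]]]; set X := _ ++ _ => /= -[sep cIn cOut].
have memv (s : seq T) (x : T) : (val x \in map val s) = (x \in s) by rewrite mem_map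
  //; apply: val_inj.
pose In := enum [pred v | (v \notin X) && I v].
pose Out := enum [pred v | (v \notin X) && ~~ I v].
exists (map val X), (map val In), (map val Out).
have sI : size In = #|[pred v | (v \notin X) && I v]| by rewrite cardE.
have sO : size Out = #|[pred v | (v \notin X) && ~~ I v]| by rewrite cardE.
rewrite -cardfE in cIn cOut.
split.
- rewrite size_map size_cat !size_traject; have := depthn a; have := depthn b; lia.
- by rewrite !(map_inj_uniq val_inj) !enum_uniq.
- rewrite !size_map sI sO. by split; [exact: cIn|exact: cOut].
- by do !split; move=> v /mapP[x _ ->]; apply: Win; apply: valP.
- split.
    move=> v /mapP[x + ->]; rewrite memv !mem_enum !inE => /andP[-> ->]; by [].
  move=> x p; elim: p x => [|y p IH] x //= /andP[exy py] pA pX.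
  have [<- <-] := IH y py (fun z h => pA z (mem_behead (s := x :: y :: p) h))
    (fun z h => pX z (mem_behead (s := x :: y :: p) h)).
  have xW : x \in W by apply: inW; apply: pA; rewrite mem_head.
  have yW : y \in W by apply: inW; apply: pA; rewrite !inE eqxx orbT.
  have xX := pX x (mem_head _ _); have yX : y \notin map val X by apply: pX;
    rewrite !inE eqxx orbT.
  have -> : x = val ([` xW]%fset : T) by [].
  have -> : y = val ([` yW]%fset : T) by [].
  have xX' : ([` xW]%fset : T) \notin X by rewrite -memv.
  have yX' : ([` yW]%fset : T) \notin X by rewrite -memv.
  by rewrite !memv !mem_enum !inE xX' yX' (sep _ _ xX' yX').
Qed.
(** * Flow through a separator *)
Section Flow.
Variables (R : realType) (V : choiceType) (e : rel V) (A : set V) (f : seq V -> R).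
Hypothesis A_fin : finite_set A.
Hypothesis f_routing : routing e A f.

Lemma paths_finite : finite_set [set p | is_path_in e A p].
Proof.
set W := fset_set A.
apply: (@sub_finite_set _ _ (\bigcup_(k in `I_(#|` W|).+1) range (fun t : k.-tuple W
  => map val t))).
  move=> p [_ up _ pA].
  have pW z : z \in p -> z \in W by move=> /pA Az; rewrite in_fset_set // inE.
  have sub : {subset p <= W} by [].
  exists (size p); first by rewrite /= ltnS; apply: uniq_leq_size.
  have sz : size (pmap insub p : seq W) == size p.
    by rewrite size_pmap_sub; apply/eqP/eqP; rewrite -all_count; apply/allP => z /pW.
  exists (Tuple sz) => //=.
  by rewrite pmap_filter ?filter_id //; [apply/all_filterP/allP => z /pW zW;
    rewrite insubT|exact: insubK].
by apply: bigcup_finite => // k _; apply: finite_image; apply: finite_finset.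
Qed.

Definition paths : seq (seq V) := fset_set [set p | is_path_in e A p].

Lemma mem_paths p : p \in paths -> is_path_in e A p.
Proof. by rewrite in_fset_set ?inE //; apply: paths_finite. Qed.

Lemma paths_sum (Q : seq V ->
  Prop) (q : pred (seq V)) : (forall p, reflect (Q p) (q p)) ->
  \sum_(p \in [set p | is_path_in e A p /\ Q p]) f p = \sum_(p <- paths | q p) f p.
Proof.
move=> qP; rewrite -[RHS]big_filter [RHS]fsbig_seq ?filter_uniq ?fset_uniq //.
apply: eq_fsbigl; apply/seteqP; split=> p /=; rewrite mem_filter in_fset_set;
  try exact: paths_finite.
  by move=> [h /qP Qp]; apply/andP; split=> //; apply/mem_set.
by move=> /andP[/qP Qp /set_mem].
Qed.

Definition joinsb (p : seq V) u v :=
  ((ohead p == Some u) && (ohead (rev p) == Some v)) ||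
  ((ohead p == Some v) && (ohead (rev p) == Some u)).

Lemma joinsP u v p : reflect (joins p u v) (joinsb p u v).
Proof.
apply: (iffP orP) => -[].
- by move=> /andP[/eqP h /eqP h']; left.
- by move=> /andP[/eqP h /eqP h']; right.
- by move=> [-> ->]; left; rewrite !eqxx.
- by move=> [-> ->]; right; rewrite !eqxx.
Qed.

Lemma path_ge0 p : p \in paths -> 0 <= f p.
Proof. by move=> /mem_paths; apply: (f_routing.1). Qed.

(** Each path between [In] and [Out] joins only one of the pairs and meets [X], so
    that it is counted at least as often in the sum of node flows as in the
    total demand between [In] and [Out]. *)
Lemma cut_flow (X In Out : seq V) : uniq In -> uniq Out ->
  (forall v, v \in In -> A v) -> (forall v, v \in Out -> A v) ->
  (forall v, v \in In -> v \notin Out) ->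
  (forall u w p, u \in In -> w \in Out -> is_path_in e A p -> joins p u w ->
     has (mem X) p) ->
  (size In * size Out)%:R <= \sum_(v <- X) node_flow e A f v.
Proof.
move=> uIn uOut InA OutA disj cut.
pose prs := [seq (u, w) | u <- In, w <- Out].
have uprs : uniq prs by apply: allpairs_uniq => // -[a b] [c d].
have -> : (size In * size Out)%:R =
    \sum_(x <- prs) \sum_(p <- paths | joinsb p x.1 x.2) f p.
  have -> : (size In * size Out)%N = size prs by rewrite size_allpairs.
  rewrite -sum1_size natr_sum [LHS]big_seq [RHS]big_seq.
  apply: eq_bigr => -[u w] /allpairsP[[u' w'] [/= hu hw [-> ->]]].
  rewrite -(paths_sum (joinsP u' w')) f_routing.2 //; [exact: InA|exact: OutA|].
  by move=> E; move: (disj _ hu); rewrite E hw.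
have -> : \sum_(v <- X) node_flow e A f v = \sum_(v <- X) \sum_(p <- paths | v \in p)
  f p.
  by apply: eq_bigr => v _; rewrite /node_flow (paths_sum (q := fun p =>
    v \in p)) // => p; apply: idP.
under eq_bigr do rewrite big_mkcond /=.
under [X in _ <= X]eq_bigr do rewrite big_mkcond /=.
rewrite exchange_big [X in _ <= X]exchange_big /= big_seq [X in _ <= X]big_seq.
apply: ler_sum => p pp; have fp := path_ge0 pp.
case: (boolP (has (fun x => joinsb p x.1 x.2) prs)) => [/hasP[x xin jx]|/hasPn none];
  last first.
  rewrite big_seq big1 ?sumr_ge0 // => [v _|x xin]; first by case: ifP.
  by rewrite (negbTE (none _ xin)).
have one y : y \in prs -> joinsb p y.1 y.2 -> y = x.
  case/allpairsP: xin jx => [[u w] [/= hu hw ->]] /= jx.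
  case/allpairsP => [[u' w'] [/= hu' hw' ->]] /= jy.
  have swap a b : a \in In -> b \in Out -> a = b -> False.
    by move=> ha hb E; move: (disj _ ha); rewrite E hb.
  case/joinsP: jx => -[E1 E2]; case/joinsP: jy => -[]; rewrite E1 E2 => -[Eu] [Ew].
  - by rewrite Eu Ew.
  - by case: (swap _ _ hu hw' Eu).
  - by case: (swap _ _ hu' hw (esym Eu)).
  - by rewrite Eu Ew.
have -> : \sum_(y <- prs) (if joinsb p y.1 y.2 then f p else 0) = f p.
  rewrite (bigD1_seq x xin uprs) /= jx big_seq_cond big1 ?addr0 // => y /andP[yin yx].
  by case: ifP => // /(one _ yin) E; rewrite E eqxx in yx.
have [v vX vp] : exists2 v, v \in X & v \in p.
  case/allpairsP: xin jx => [[u w] [/= hu hw ->]] /= /joinsP jx.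
  by have /hasP[v vp vX] := cut _ _ _ hu hw (mem_paths pp) jx; exists v.
rewrite (big_rem v vX) /= vp lerDl sumr_ge0 // => z _.
by case: ifP.
Qed.

Lemma some_heavy_node (X : seq V) (c : R) : (0 < size X)%N ->
  c <= \sum_(v <- X) node_flow e A f v ->
  exists2 v, v \in X & c / (size X)%:R <= node_flow e A f v.
Proof.
move=> X0 h; apply: contrapT => none.
have : \sum_(v <- X) node_flow e A f v < \sum_(v <- X) c / (size X)%:R.
  case: X X0 h none => // x X _ _ none; rewrite big_cons [X in _ < X]big_cons.
  have lt v : v \in x :: X -> node_flow e A f v < c / (size (x :: X))%:R.
    by move=> vX; rewrite ltNge; apply/negP => le; apply: none; exists v.
  apply: ltr_leD; first by apply: lt; rewrite mem_head.
  by rewrite big_seq [X in _ <= X]big_seq; apply: ler_sum => v vX; apply/ltW/lt;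
    rewrite inE vX orbT.
rewrite big_const_seq count_predT iter_addr_0 -[X in _ < X]mulr_natr mulfVK
  ?pnatr_eq0 -?lt0n //.
by move=> /lt_le_trans/(_ h); rewrite ltxx.
Qed.

End Flow.

Lemma bernoulli (R : realFieldType) (h : R) n : 0 <= h -> 1 + n%:R * h <= (1 + h) ^+ n.
Proof.
move=> h0; elim: n => [|n IH]; first by rewrite mul0r addr0 expr0.
rewrite exprS; apply: le_trans (_ : _ <= (1 + h) * (1 + n%:R * h)) _; last first.
  by rewrite ler_wpM2l // addr_ge0.
rewrite -natr1; have : 0 <= n%:R * (h * h) by rewrite mulr_ge0 // mulr_ge0.
by rewrite !mulrDl !mulrDr; lra.
Qed.

(** Bernoulli applied to half of the exponent gives quadratic growth. *)
Lemma exp_beats_linear (R : realType) (lam c : R) : 1 < lam ->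
  exists n1 : nat, forall n, (n1 <= n)%N -> c * n.+1%:R <= lam ^+ n.
Proof.
move=> l1; pose h := lam - 1; have h0 : 0 < h by rewrite subr_gt0.
have lE : lam = 1 + h by rewrite /h addrC subrK.
pose K := 4 * `|c| / (h * h).
have K0 : 0 <= K by rewrite divr_ge0 ?mulr_ge0 // ltW.
pose m1 := (Num.trunc K).+1.
exists (2 * m1)%N => n mn; pose m := n./2.
have m1m : (m1 <= m)%N by rewrite /m; lia.
have nm : (n.+1 <= 2 * m.+1)%N by rewrite /m; lia.
have Km : K <= m%:R.
  apply: ltW; apply: lt_le_trans (_ : _ < m1%:R) _; last by rewrite ler_nat.
  exact: truncnS_gt.
have m0 : 1 <= m%:R :> R by rewrite ler1n; apply: leq_trans m1m.
have b1 : m%:R * h <= (1 + h) ^+ m by apply: le_trans (bernoulli m (ltW h0));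
  rewrite lerDr.
have b2 : (m%:R * h) ^+ 2 <= lam ^+ n.
  apply: le_trans (_ : _ <= ((1 + h) ^+ m) ^+ 2) _.
    by rewrite !expr2 ler_pM // mulr_ge0 // ltW.
  rewrite -exprM -lE; apply: ler_weXn2l; first exact: ltW.
  by rewrite /m; lia.
apply: le_trans b2; apply: le_trans (_ : _ <= `|c| * (4 * m%:R)) _.
  apply: le_trans (_ : _ <= `|c| * n.+1%:R) _; first by rewrite ler_wpM2r // ler_norm.
  rewrite ler_wpM2l //; apply: le_trans (_ : _ <= (2 * m.+1)%:R) _;
    first by rewrite ler_nat.
  by rewrite natrM -[m.+1%:R]natr1; lra.
have -> : `|c| * (4 * m%:R) = (K * (h * h)) * m%:R.
  by rewrite /K divfK ?mulf_neq0 ?gt_eqF //; ring.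
have -> : (m%:R * h) ^+ 2 = (m%:R * (h * h)) * m%:R by ring.
by rewrite ler_wpM2r // ler_wpM2r // mulr_ge0 // ltW.
Qed.

(** * The congestion bound *)
Theorem corollary2p2 (R : realType) (V : choiceType) (e : rel V) (x0 : V)
    (e_simple : simple_graph e)
    (e_connected : connected_graph e)
    (e_locally_finite : locally_finite_graph e)
    (V_infinite : infinite_set [set: V])
    (e_planar : planar R e)
    (e_growth : exponential_growth R e x0) :
  exists2 C : R, 0 < C &
    exists n1 : nat, forall n : nat, (n1 <= n)%N ->
      forall f : seq V -> R, routing e (gball e x0 n) f ->
        exists2 v : V, gball e x0 n v &
          C * ((gball_size e x0 n)%:R ^+ 2 / ln (gball_size e x0 n)%:R)
            <= node_flow e (gball e x0 n) f v.
Proof.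
have [n0 [lam [lam1 growth]]] := e_growth.
(* 24 makes the separator at most a twelfth of the ball *)
have [n1 lin] := exp_beats_linear 24 lam1.
have l0 : 0 < ln lam by rewrite ln_gt0.
exists (ln lam / 64); first by rewrite divr_gt0.
exists (maxn n0 (maxn n1 1)) => n; rewrite !geq_max => /and3P[nn0 nn1 n_gt0] f rf.
set A := gball e x0 n; set N := gball_size e x0 n.
have Ngrow : lam ^+ n <= N%:R := growth n nn0.
have Nlin : (24 * n.+1 <= N)%N.
  by rewrite -(ler_nat R) natrM; apply: le_trans Ngrow; apply: lin.
have N7 : (7 <= N)%N by lia.
have [X [In [Out [/andP[X0 Xn] [uIn uOut] [cIn cOut] [XA [InA OutA]] [disj sep]]]]] :=
  ball_separator e_simple e_connected e_locally_finite e_planar N7.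
rewrite -/N -/A in cIn cOut XA InA OutA sep.
have nIn : (N <= 4 * size In)%N by clear - cIn Xn Nlin; lia.
have nOut : (N <= 4 * size Out)%N by clear - cOut Xn Nlin; lia.
have sizeX : (size X <= 4 * n)%N by clear - Xn n_gt0; lia.
have A_fin : finite_set A by apply: gball_finite.
have cut u w p : u \in In -> w \in Out -> is_path_in e A p -> joins p u w ->
    has (mem X) p.
  move=> uin win [_ _ sp pA] jn; apply/negPn/negP => /hasPn nX.
  case: p sp pA jn nX => [|x p] /= sp pA jn nX; first by case: jn => -[].
  have [sIn sOut] := sep x p sp pA nX.
  have lE : ohead (rev (x :: p)) = Some (last x p) by rewrite lastI rev_rcons.
  case: jn => -[[E1]]; rewrite lE => -[E2]; subst.
    by move: (disj _ uin); rewrite -sOut in win *; move: sOut; rewrite win.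
  by move: (disj _ uin); move: sOut; rewrite win => <-.
have flow := cut_flow A_fin rf uIn uOut InA OutA disj cut.
have [v vX hv] := some_heavy_node X0 flow.
exists v; first exact: XA.
apply: le_trans hv.
have n0' : (0 : R) < n%:R by rewrite ltr0n.
have N0 : (0 : R) < N%:R by rewrite ltr0n; apply: leq_trans N7.
have X0' : (0 : R) < (size X)%:R by rewrite ltr0n.
have lnN : n%:R * ln lam <= ln N%:R.
  rewrite mulrC mulr_natr -lnXn ?(lt_trans ltr01) //.
  by rewrite ler_ln ?posrE // exprn_gt0 // (lt_trans ltr01).
have lnN0 : 0 < ln (N%:R : R) by apply: lt_le_trans lnN; rewrite mulr_gt0.
have cI : N%:R <= 4 * (size In)%:R :> R by rewrite -natrM ler_nat.
have cO : N%:R <= 4 * (size Out)%:R :> R by rewrite -natrM ler_nat.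
have cX : (size X)%:R <= 4 * n%:R :> R by rewrite -natrM ler_nat.
have NN : N%:R ^+ 2 <= 16 * (size In * size Out)%:R :> R.
  have -> : 16 * (size In * size Out)%:R = (4 * (size In)%:R) * (4 * (size Out)%:R)
    :> R.
    by rewrite natrM; ring.
  by rewrite expr2 ler_pM // ltW.
have ratio : ln lam * (size X)%:R / ln N%:R <= 4.
  rewrite ler_pdivrMr //; apply: le_trans (_ : _ <= ln lam * (4 * n%:R)) _.
    by rewrite ler_wpM2l // ltW.
  by rewrite mulrCA ler_wpM2l // mulrC.
rewrite ler_pdivlMr //.
have -> : ln lam / 64 * (N%:R ^+ 2 / ln N%:R) * (size X)%:R =
    (ln lam * (size X)%:R / ln N%:R) * (N%:R ^+ 2 / 64) :> R by ring.
apply: le_trans (_ : _ <= 4 * (N%:R ^+ 2 / 64)) _; last by lra.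
by rewrite ler_wpM2r // divr_ge0 // exprn_ge0.
Qed.
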